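(* The proof system $\mathcal{H}^{-}_{\mathsf{DPL}}$ is decidable: there is an algorithm which, given a formula $\varphi$ of $\mathcal{L}_{\mathsf{DPL}}$, decides whether $\varphi$ is a theorem of $\mathcal{H}^{-}_{\mathsf{DPL}}$.
   Context: Let $\mathbb{P}$ be a countable set of propositional variables. The formulas of $\mathcal{L}_{\mathsf{DPL}}$ are given by $\varphi ::= p \mid \neg\varphi \mid \varphi\wedge\varphi \mid L_r\varphi \mid \bigcirc\varphi$ with $p\in\mathbb{P}$, $r\in\mathbb{Q}\cap[0,1]$; $\bigcirc^n$ is $n$-fold iteration of $\bigcirc$. The Hilbert system $\mathcal{H}^{-}_{\mathsf{DPL}}$ has the axiom schemes: propositional tautologies; $L_0\bot$; $L_r\neg\varphi\to\neg L_s\varphi$ if $r+s>1$; $L_r(\varphi\wedge\psi)\wedge L_s(\varphi\wedge\neg\psi)\to L_{r+s}\varphi$ if $r+s\le 1$; $\neg L_r(\varphi\wedge\psi)\wedge\neg L_s(\varphi\wedge\neg\psi)\to\neg L_{r+s}\varphi$ if $r+s\le1$; $L_1(\varphi\to\psi)\to(L_r\varphi\to L_r\psi)$; $\bigcirc\neg\varphi\leftrightarrow\neg\bigcirc\varphi$; $\bigcirc(\varphi\wedge\psi)\leftrightarrow(\bigcirc\varphi\wedge\bigcirc\psi)$; and rules: modus ponens; from $\{\psi\to\bigcirc^nL_s\varphi \mid s<r,\ s\in\mathbb{Q}\cap[0,1]\}$ infer $\psi\to\bigcirc^nL_r\varphi$ (each $n\in\mathbb{N}$); from $\varphi$ infer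 $L_1\varphi$; from $\varphi$ infer $\bigcirc\varphi$. Theorems are last elements of (possibly transfinite, countable-length) derivations in which each element is an axiom or follows by a rule from earlier elements. (Equivalently, the theorems are exactly the formulas valid in all dynamic Markov processes $\langle\Omega,\mathcal{A},T,f\rangle$, with $T$ a Markov kernel and $f$ measurable, under the semantics $w\vDash L_r\varphi$ iff $T(w,[\![\varphi]\!])\ge r$ and $w\vDash\bigcirc\varphi$ iff $f(w)\vDash\varphi$.) *)

(* Defs.v *)
From HB Require Import structures.
From mathcomp Require Import all_boot all_order all_algebra.

Set Implicit Arguments.
Unset Strict Implicit.
Unset Printing Implicit Defensive.

Import Order.TTheory GRing.Theory Num.Theory.

Definition q01 := {r : rat | (0 <= r <= 1)%R}.

Definition q0 : q01 := exist _ 0%R isT.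
Definition q1 : q01 := exist _ 1%R isT.

Section Logic.
Variable P : Type.

Inductive form : Type :=
| Var of P
| Neg of form
| And of form & form
| L of q01 & form
| Next of form.

Definition Imp (phi psi : form) := Neg (And phi (Neg psi)).
Definition Iff (phi psi : form) := And (Imp phi psi) (Imp psi phi).

(* The language has no primitive falsum; any contradiction chi /\ ~ chi
   plays its role. *)
Definition Bot (chi : form) := And chi (Neg chi).

(* Variables, L_r-formulas and Next-formulas all act as propositional atoms,
   so the tautologies are the substitution instances in [form] of the
   tautologies of classical propositional logic. *)
Fixpoint bool_eval (v : form -> bool) (phi : form) : bool :=
  match phi with
  | Neg psi => ~~ bool_eval v psi
  | And psi chi => bool_eval v psi && bool_eval v chi
  | _ => v phi
  end.

Definition tautology (phi : form) := forall v, bool_eval v phi.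

(* In [ax_add] and [ax_sub] the index t of type [q01] with t = r + s carries
   the side condition r + s <= 1. *)
Inductive axiom : form -> Prop :=
| ax_taut phi : tautology phi -> axiom phi
| ax_zero chi : axiom (L q0 (Bot chi))
| ax_neg (r s : q01) phi : (1 < val r + val s)%R ->
    axiom (Imp (L r (Neg phi)) (Neg (L s phi)))
| ax_add (r s t : q01) phi psi : val t = (val r + val s)%R ->
    axiom (Imp (And (L r (And phi psi)) (L s (And phi (Neg psi)))) (L t phi))
| ax_sub (r s t : q01) phi psi : val t = (val r + val s)%R ->
    axiom (Imp (And (Neg (L r (And phi psi))) (Neg (L s (And phi (Neg psi)))))
               (Neg (L t phi)))
| ax_mono (r : q01) phi psi :
    axiom (Imp (L q1 (Imp phi psi)) (Imp (L r phi) (L r psi)))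
| ax_next_neg phi : axiom (Iff (Next (Neg phi)) (Neg (Next phi)))
| ax_next_and phi psi :
    axiom (Iff (Next (And phi psi)) (And (Next phi) (Next psi))).

(* [follows G phi]: phi is the conclusion of a rule all of whose premises
   lie in G. *)
Inductive follows (G : form -> Prop) : form -> Prop :=
| r_mp phi psi : G phi -> G (Imp phi psi) -> follows G psi
| r_arch (n : nat) (r : q01) phi psi :
    (forall s : q01, (val s < val r)%R -> G (Imp psi (iter n Next (L s phi)))) ->
    follows G (Imp psi (iter n Next (L r phi)))
| r_nec_L phi : G phi -> follows G (L q1 phi)
| r_nec_next phi : G phi -> follows G (Next phi).

Definition well_order (I : Type) (lt : I -> I -> Prop) :=
  [/\ well_founded lt,
      forall i j k, lt i j -> lt j k -> lt i k
    & forall i j, [\/ lt i j, i = j | lt j i]].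

(* A sequence of countable ordinal length, indexed by a countable
   well-ordered type. *)
Definition derivation (I : countType) (lt : I -> I -> Prop) (d : I -> form) :=
  well_order lt /\
  forall i, axiom (d i) \/ follows (fun psi => exists2 j, lt j i & d j = psi) (d i).

Definition is_theorem (phi : form) :=
  exists (I : countType) (lt : I -> I -> Prop) (d : I -> form),
    derivation lt d /\
    exists2 l : I, (forall i, i <> l -> lt i l) & d l = phi.

End Logic.

(* Kleene's total recursive functions: minimization is applied only when it
   yields a total function.  In [rec_prim] the recursion variable is the
   first component. *)
Inductive recursive : forall n, (n.-tuple nat -> nat) -> Prop :=
| rec_zero n : recursive (fun _ : n.-tuple nat => 0)
| rec_succ : recursive (fun x : 1.-tuple nat => (thead x).+1)
| rec_proj n (i : 'I_n) : recursive (fun x : n.-tuple nat => tnth x i)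
| rec_comp m n (g : m.-tuple nat -> nat) (h : 'I_m -> n.-tuple nat -> nat) :
    recursive g -> (forall i, recursive (h i)) ->
    recursive (fun x : n.-tuple nat => g [tuple h i x | i < m])
| rec_prim n (g : n.-tuple nat -> nat) (h : n.+2.-tuple nat -> nat) :
    recursive g -> recursive h ->
    recursive (fun x : n.+1.-tuple nat =>
      iteri (thead x) (fun k y => h [tuple of [:: k, y & behead_tuple x]])
            (g (behead_tuple x)))
| rec_mu n (g : n.+1.-tuple nat -> nat) (f : n.-tuple nat -> nat) :
    recursive g ->
    (forall x, g [tuple of f x :: x] = 0 /\
               forall k, k < f x -> g [tuple of k :: x] <> 0) ->
    recursive f.

(* A set A of objects numbered by [code] is decidable when a single total
   recursive function decides it on codes; its values at numbers that are
   not codes are irrelevant. *)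
Definition decidable_via (T : Type) (code : T -> nat) (A : T -> Prop) :=
  exists2 d : nat -> bool,
    recursive (fun x : 1.-tuple nat => nat_of_bool (d (thead x)))
    & forall t, d (code t) <-> A t.

(* Cantor's pairing function *)
Definition cpair (x y : nat) : nat := ((x + y) * (x + y).+1)./2 + y.

Definition code_q01 (r : q01) : nat :=
  cpair `|numq (val r)|%N `|denq (val r)|%N.

Fixpoint code (P : countType) (phi : form P) : nat :=
  match phi with
  | Var p => cpair 0 (pickle p)
  | Neg psi => cpair 1 (code psi)
  | And psi chi => cpair 2 (cpair (code psi) (code chi))
  | L r psi => cpair 3 (cpair (code_q01 r) (code psi))
  | Next psi => cpair 4 (code psi)
  end.

Lemma cpair_inj x y x' y' : cpair x y = cpair x' y' -> x = x' /\ y = y'.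
Proof.
have tri a : ((a.+1 * a.+2)./2 = (a * a.+1)./2 + a.+1)%N.
  have -> : (a.+1 * a.+2 = a * a.+1 + a.+1.*2)%N.
    by rewrite mulnC -addn2 mulnDl mul2n.
  by rewrite halfD doubleK odd_double andbF add0n.
have mono a b : (a <= b -> (a * a.+1)./2 <= (b * b.+1)./2)%N.
  by move=> ab; apply/half_leq/leq_mul.
have lt a b u v : (a < b -> u <= a -> (a * a.+1)./2 + u < (b * b.+1)./2 + v)%N.
  move=> ab ua; apply: leq_trans (leq_addr _ _).
  by apply: leq_trans (mono _ _ ab); rewrite tri -addnS leq_add2l.
rewrite /cpair => E.
have S : (x + y = x' + y')%N.
  by case: (ltngtP (x + y) (x' + y')) => // H;
    [have := lt _ _ y y' H (leq_addl _ _) | have := lt _ _ y' y H (leq_addl _ _)];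
    rewrite E ltnn.
move: E; rewrite S => /addnI yy; split=> //.
by move: S; rewrite yy => /addIn.
Qed.

Lemma code_q01_inj : injective code_q01.
Proof.
move=> [r r01] [s s01] /cpair_inj /= [] en [] ed.
apply: val_inj => /=; rewrite -[r]divq_num_den -[s]divq_num_den.
case/andP: r01 => r0 _; case/andP: s01 => s0 _.
have -> : numq r = numq s.
  by rewrite -[LHS]gez0_abs ?numq_ge0 // en gez0_abs ?numq_ge0.
suff -> : denq r = denq s by [].
by rewrite -[LHS]gez0_abs ?denq_ge0 // ed gez0_abs ?denq_ge0.
Qed.

Lemma code_inj (P : countType) : injective (@code P).
Proof.
elim=> [p|f IH|f IHf g IHg|r f IH|f IH] [q|f'|f' g'|s f'|f'] /cpair_inj //= [] // _.
- by move/(pcan_inj pickleK)=> ->.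
- by move/IH=> ->.
- by case/cpair_inj=> /IHf -> /IHg ->.
- by case/cpair_inj=> /code_q01_inj -> /IH ->.
- by move/IH=> ->.
Qed.

(* Main.v *)
From mathcomp Require Import all_boot all_order all_algebra.
From mathcomp Require Import boolp classical_sets reals Rstruct.
From mathcomp Require Import zify ring lra.
(* After the library, whose [form] would otherwise shadow the formulas. *)
Require Import Defs.

Set Implicit Arguments.
Unset Strict Implicit.
Unset Printing Implicit Defensive.

Import Order.TTheory GRing.Theory Num.Theory.

(** A formula phi is refutable iff it fails in a finite model whose states are
    truth assignments to the subformulas of phi, each carrying a successor for
    Next and a probability weight on the states that realises exactly the
    formulas [L r psi] it asserts.  Such a model exists for every non-theorem:
    take as states the types realised by the maximal consistent theories closed
    under the infinitary rule; in such a theory, psi |-> sup {r | L r psi} is a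
    finitely additive real probability.  The weights have to satisfy homogeneous
    linear (in)equalities with bounded integer coefficients.  Any real vector can
    be replaced by an integer vector of computably bounded size on which all
    linear forms with coefficients bounded by K have the same signs: going from n
    to n + 1 coordinates, the new coordinate only has to fall in the same cell of
    the line cut at the quotients of the forms in the other n coordinates, and
    the order of these quotients is read off from the signs of forms with
    coefficients bounded by 2K^2.  Hence both the models and the weights can be
    searched below a bound computed from phi, and no unbounded minimisation is
    needed. *)

(** * Recursive functions *)

(* F is a function of an environment of de Bruijn variables: a bound variable
   is pushed at the head. *)
Definition pr (F : seq nat -> nat) :=
  forall n, recursive (fun x : n.-tuple nat => F x).

Definition prb (F : seq nat -> bool) := pr (fun e => F e : nat).

Lemma pr_ext F G : F =1 G -> pr F -> pr G.
Proof. by move=> /funext ->. Qed.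

Lemma pr_succ F : pr F -> pr (fun e => (F e).+1).
Proof.
move=> pF n.
have := rec_comp (h := fun (_ : 'I_1) (x : n.-tuple nat) => F x) rec_succ
  (fun=> pF n).
by congr recursive; apply/funext => x; rewrite /thead tnth_mktuple.
Qed.

Lemma pr_cst k : pr (fun=> k).
Proof. by elim: k => [|k IH]; [move=> n; exact: rec_zero | exact: pr_succ]. Qed.

(** Since [pr] ranges over all arities, the environment may be too short to contain entry [i]; it
    then reads the default 0, a constant function. *)
Lemma pr_nth i : pr (fun e => nth 0 e i).
Proof.
move=> n; case: (ltnP i n) => [lt_in|le_ni].
  suff -> : (fun x : n.-tuple nat => nth 0 x i) = fun x => tnth x (Ordinal lt_in).
    exact: rec_proj.
  by apply/funext => x; rewrite (tnth_nth 0).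
suff -> : (fun x : n.-tuple nat => nth 0 x i) = fun=> 0 by exact: rec_zero.
by apply/funext => x; rewrite nth_default ?size_tuple.
Qed.

Lemma pr_nth_behead k i : pr (fun e => nth 0 (iter k behead e) i).
Proof.
apply: pr_ext (pr_nth (k + i)) => e.
by elim: k i => // k IH i; rewrite /= nth_behead -IH addnS.
Qed.

(** The step function lives on the environment extended by the counter and then the accumulator, the
    order of [rec_prim]. The iteration count [T] is supplied by composing with the function that
    pushes [T e] on [e]. *)
Lemma pr_iteri T g h : pr T -> pr g ->
  pr (fun e => h (nth 0 e 0) (nth 0 (behead e) 0) (behead (behead e))) ->
  pr (fun e => iteri (T e) (fun k y => h k y e) (g e)).
Proof.
move=> pT pg ph n.
have := rec_prim (pg n) (ph n.+2).
pose H (i : 'I_n.+1) (x : n.-tuple nat) := nth 0 (T x :: x) i.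
have pH i : recursive (H i).
  by case: (unliftP ord0 i) => [j ->|->]; [exact: pr_nth | exact: pT].
move=> /(fun r => rec_comp r pH); congr recursive; apply/funext => x.
have -> : [tuple H i x | i < n.+1] = [tuple of T x :: x].
  by apply: eq_from_tnth => i; rewrite tnth_mktuple (tnth_nth 0).
by rewrite theadE.
Qed.

Lemma pr_iter T g h : pr T -> pr g ->
  pr (fun e => h (nth 0 (behead e) 0) (behead (behead e))) ->
  pr (fun e => iter (T e) (fun y => h y e) (g e)).
Proof.
move=> pT pg ph; apply: pr_ext (pr_iteri (h := fun=> h) pT pg ph) => e.
by elim: (T e) => //= k ->.
Qed.

Lemma pr_add F G : pr F -> pr G -> pr (fun e => F e + G e).
Proof.
move=> pF pG; apply: pr_ext (pr_iter (h := fun y _ => y.+1) pG pF _) => [e|].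
  by elim: (G e) => [|k /= ->]; rewrite ?addn0 ?addnS.
exact/pr_succ/(pr_nth_behead 1).
Qed.

Lemma pr_pred F : pr F -> pr (fun e => (F e).-1).
Proof.
move=> pF; apply: pr_ext (pr_iteri (h := fun k _ _ => k) pF (pr_cst 0) _) => [e|].
  by case: (F e).
exact: (pr_nth 0).
Qed.

Lemma pr_sub F G : pr F -> pr G -> pr (fun e => F e - G e).
Proof.
move=> pF pG; apply: pr_ext (pr_iter (h := fun y _ => y.-1) pG pF _) => [e|].
  by elim: (G e) => [|k /= ->]; rewrite ?subn0 ?subnS.
exact/pr_pred/(pr_nth_behead 1).
Qed.

(** Recursive functions have a fixed arity, so the length of the new environment may depend only on
    the length of the old one. *)
Lemma pr_subst F (s : seq nat -> seq nat) : pr F ->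
  (forall i, pr (fun e => nth 0 (s e) i)) ->
  (forall e e', size e = size e' -> size (s e) = size (s e')) ->
  pr (fun e => F (s e)).
Proof.
move=> pF ps sz n; pose m := size (s (nseq n 0)).
have := rec_comp (h := fun (i : 'I_m) (x : n.-tuple nat) => nth 0 (s x) i)
  (pF m) (fun i => ps i n).
congr recursive; apply/funext => x /=; congr F.
have szx : size (s x) = m by apply: sz; rewrite size_nseq size_tuple.
apply: (@eq_from_nth _ 0) => [|i]; rewrite size_map size_enum_ord ?szx // => lt_im.
by rewrite (nth_map (Ordinal lt_im)) ?size_enum_ord // nth_enum_ord.
Qed.

Lemma pr_behead F : pr F -> pr (fun e => F (behead e)).
Proof.
move=> pF; apply: pr_subst => // [i|e e' sz]; first exact: (pr_nth_behead 1).
by rewrite !size_behead sz.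
Qed.

(** Hides the accumulator that lies below the counter: the summand in [pr_sum] sees its index but
    not the running sum. *)
Lemma pr_skip F : pr F -> pr (fun e => F (nth 0 e 0 :: behead (behead e))).
Proof.
move=> pF; apply: (pr_subst (s := fun e => nth 0 e 0 :: _)) => // [[|i]|e e' sz] /=.
- exact: pr_nth.
- exact: (pr_nth_behead 2).
- by rewrite !size_behead sz.
Qed.

Lemma pr_sum T B : pr T -> pr (fun e => B (nth 0 e 0) (behead e)) ->
  pr (fun e => \sum_(0 <= i < T e) B i e).
Proof.
move=> pT pB.
apply: pr_ext (pr_iteri (h := fun k y e => y + B k e) pT (pr_cst 0) _) => [e|].
  by elim: (T e) => [|k /= ->]; rewrite ?big_nil // big_nat_recr ?big_nil.
apply: pr_add; [exact: (pr_nth_behead 1) | exact: (pr_skip pB)].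
Qed.

Lemma pr_mul F G : pr F -> pr G -> pr (fun e => F e * G e).
Proof.
move=> pF pG; apply: pr_ext (pr_iter (h := fun y e => F e + y) pG (pr_cst 0) _) => [e|].
  by elim: (G e) => [|k /= ->]; rewrite ?muln0 ?mulnS.
apply: pr_add; [exact: (pr_behead (pr_behead pF)) | exact: (pr_nth_behead 1)].
Qed.

Lemma prb_neg b : prb b -> prb (fun e => ~~ b e).
Proof.
by move=> pb; apply: pr_ext (pr_sub (pr_cst 1) pb) => e; case: (b e).
Qed.

Lemma prb_and a b : prb a -> prb b -> prb (fun e => a e && b e).
Proof.
by move=> pa pb; apply: pr_ext (pr_mul pa pb) => e; case: (a e); case: (b e).
Qed.

Lemma prb_or a b : prb a -> prb b -> prb (fun e => a e || b e).
Proof.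
move=> pa pb; apply: pr_ext (prb_neg (prb_and (prb_neg pa) (prb_neg pb))) => e.
by rewrite negb_and !negbK.
Qed.

Lemma prb_imp a b : prb a -> prb b -> prb (fun e => a e ==> b e).
Proof.
move=> pa pb; apply: pr_ext (prb_or (prb_neg pa) pb) => e.
by rewrite implybE.
Qed.

Lemma prb_leq F G : pr F -> pr G -> prb (fun e => F e <= G e).
Proof.
move=> pF pG; apply: pr_ext (pr_sub (pr_cst 1) (pr_sub pF pG)) => e.
by rewrite /leq; case: (F e - G e).
Qed.

Lemma prb_eq F G : pr F -> pr G -> prb (fun e => F e == G e).
Proof.
move=> pF pG; apply: pr_ext (prb_and (prb_leq pF pG) (prb_leq pG pF)) => e.
by rewrite eqn_leq.
Qed.

Lemma prb_eqb a b : prb a -> prb b -> prb (fun e => a e == b e).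
Proof.
by move=> pa pb; apply: pr_ext (prb_eq pa pb) => e; case: (a e); case: (b e).
Qed.

(** * Bounded quantifiers, division and digits *)

Definition ball n (b : nat -> bool) := all b (iota 0 n).
Definition bex n (b : nat -> bool) := has b (iota 0 n).

Lemma ballP n (b : nat -> bool) : reflect (forall i, i < n -> b i) (ball n b).
Proof.
apply: (iffP allP) => bn i; first by move=> lt_in; apply: bn; rewrite mem_iota.
by rewrite mem_iota => /bn.
Qed.

Lemma bexP n (b : nat -> bool) : reflect (exists2 i, i < n & b i) (bex n b).
Proof.
apply: (iffP hasP) => -[i lt_in bi]; exists i => //; first by rewrite mem_iota in lt_in.
by rewrite mem_iota.
Qed.

Lemma prb_bex T b : pr T -> prb (fun e => b (nth 0 e 0) (behead e)) ->
  prb (fun e => bex (T e) (fun i => b i e)).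
Proof.
move=> pT pb.
apply: pr_ext (prb_leq (pr_cst 1) (pr_sum (B := fun i e => b i e) pT pb)) => e.
congr nat_of_bool; rewrite big_mkord lt0n sum_nat_eq0.
apply/forallPn/bexP => [[i]|[i lt_in bi]].
  by rewrite eqb0 negbK => bi; exists i.
by exists (Ordinal lt_in); rewrite eqb0 negbK.
Qed.

Lemma prb_ball T b : pr T -> prb (fun e => b (nth 0 e 0) (behead e)) ->
  prb (fun e => ball (T e) (fun i => b i e)).
Proof.
move=> pT pb; apply: pr_ext (prb_neg (prb_bex (b := fun i e => ~~ b i e) pT _)).
  by move=> e; rewrite /bex has_predC negbK.
exact: prb_neg.
Qed.

Lemma pr_exp F G : pr F -> pr G -> pr (fun e => F e ^ G e).
Proof.
move=> pF pG; apply: pr_ext (pr_iter (h := fun y e => F e * y) pG (pr_cst 1) _) => [e|].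
  by elim: (G e) => [|k /= ->]; rewrite ?expn0 ?expnS.
apply: pr_mul; [exact: (pr_behead (pr_behead pF)) | exact: (pr_nth_behead 1)].
Qed.

(** For positive [G] the quotient counts the [i < F] with [i.+1 * G <= F]; the guard [0 < G]
    produces the value 0 for division by 0. *)
Lemma pr_div F G : pr F -> pr G -> pr (fun e => F e %/ G e).
Proof.
move=> pF pG.
have pB : prb (fun e => (nth 0 e 0).+1 * G (behead e) <= F (behead e)).
  apply: prb_leq; last exact: pr_behead.
  by apply: pr_mul; [exact/pr_succ/pr_nth | exact: pr_behead].
have pB' := prb_and (prb_leq (pr_cst 1) (pr_behead pG)) pB.
apply: pr_ext (pr_sum (B := fun i e => (0 < G e) && (i.+1 * G e <= F e)) pF pB').
move=> e; case: posnP => [->|G0]; first by rewrite divn0 big1.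
have sum_lt m k : \sum_(0 <= i < m) (i < k) = minn m k.
  by elim: m => [|m IH]; rewrite ?big_nil ?min0n // big_nat_recr //= IH; lia.
under eq_bigr do rewrite -leq_divRL //=.
by rewrite sum_lt (minn_idPr _) ?leq_div.
Qed.

Lemma pr_mod F G : pr F -> pr G -> pr (fun e => F e %% G e).
Proof.
move=> pF pG; apply: pr_ext (pr_sub pF (pr_mul (pr_div pF pG) pG)) => e.
by rewrite {1}(divn_eq (F e) (G e)) addKn.
Qed.

Lemma pr_cpair F G : pr F -> pr G -> pr (fun e => cpair (F e) (G e)).
Proof.
move=> pF pG; apply: pr_add => //.
have pS := pr_add pF pG.
apply: pr_ext (pr_div (pr_mul pS (pr_succ pS)) (pr_cst 2)) => e.
by rewrite divn2.
Qed.

(* Finite functions and finite sets of numbers are coded by their digits. *)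
Definition dig B w t := (w %/ B ^ t) %% B.
Definition bit x s := dig 2 s x == 1.

Lemma pr_dig F G H : pr F -> pr G -> pr H -> pr (fun e => dig (F e) (G e) (H e)).
Proof. by move=> pF pG pH; apply/pr_mod => //; apply/pr_div => //; apply: pr_exp. Qed.

Lemma prb_bit F G : pr F -> pr G -> prb (fun e => bit (F e) (G e)).
Proof. by move=> pF pG; apply/prb_eq/pr_cst/pr_dig => //; apply: pr_cst. Qed.

(* A closed form dominating [sign_bound_rec] below, in which the growing
   coefficient bounds K, 2K^2, ... are all replaced by the last one. *)
Definition sign_bound n K :=
  let M := iter n (fun k => 2 * (k * k)) K in
  iter n (fun g => 2 * (M * M) * (n * M * g + 1)) 1.

(* C is a set of codes closed under immediate subformulas, X a set of states,
   s a state, i.e. the set of the codes in C that it makes true; s' is the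
   successor of s and w assigns to each state its unnormalised weight at s.
   Subformulas have smaller codes and X < 2 ^ N, so all searches are bounded. *)
Definition good_world c C X s :=
  let N := 2 ^ c.+1 in
  let B := (sign_bound N c.+1).+1 in
  [&& ball c.+1 (fun x => bit (cpair 1 x) C ==>
        bit x C && (bit (cpair 1 x) s == ~~ bit x s)),
      ball c.+1 (fun x => ball c.+1 (fun y => bit (cpair 2 (cpair x y)) C ==>
        [&& bit x C, bit y C
          & bit (cpair 2 (cpair x y)) s == bit x s && bit y s])),
      bex N (fun s' => bit s' X &&
        ball c.+1 (fun x => bit (cpair 4 x) C ==>
          bit x C && (bit (cpair 4 x) s == bit x s')))
    & bex (B ^ N) (fun w =>
        [&& ball N (fun t => (0 < dig B w t) ==> bit t X),
            0 < \sum_(0 <= t < N) dig B w t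
          & ball c.+1 (fun a => ball c.+1 (fun b => ball c.+1 (fun x =>
              let m := cpair 3 (cpair (cpair a b) x) in
              bit m C ==> bit x C && (bit m s ==
                (a * \sum_(0 <= t < N) dig B w t <=
                 b * \sum_(0 <= t < N) bit x t * dig B w t)))))])].

(** A state is a set of codes at most [c], so there are [N] states and [2 ^ N] sets of states.
    Acceptance means that no pair [C], [X] all of whose states are good refutes [c]. *)
Definition decide c :=
  let N := 2 ^ c.+1 in
  ball N (fun C => ball (2 ^ N) (fun X => bit c C ==>
    ball N (fun s => bit s X ==> good_world c C X s) ==>
    ball N (fun s => bit s X ==> bit c s))).

(** All tests [==] in [decide] compare booleans, whence [prb_eqb]. In the last case [go] finds how
    many binders separate a variable from the head of the environment. *)
Ltac pr_tac := cbv beta; lazymatch goal with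
| |- prb (fun e => ball (@?T e) (fun i => @?b e i)) =>
  refine (@prb_ball T (fun i e => b e i) _ _); pr_tac
| |- prb (fun e => bex (@?T e) (fun i => @?b e i)) =>
  refine (@prb_bex T (fun i e => b e i) _ _); pr_tac
| |- prb (fun e => _ && _) => apply: prb_and; pr_tac
| |- prb (fun e => _ ==> _) => apply: prb_imp; pr_tac
| |- prb (fun e => ~~ _) => apply: prb_neg; pr_tac
| |- prb (fun e => bit _ _) => apply: prb_bit; pr_tac
| |- prb (fun e => _ <= _) => apply: prb_leq; pr_tac
| |- prb (fun e => _ == _) => apply: prb_eqb; pr_tac
| |- pr (fun e => \sum_(0 <= i < @?T e) @?b e i) =>
  refine (@pr_sum T (fun i e => b e i) _ _); pr_tac
| |- pr (fun e => iter (@?T e) (fun y => @?h e y) (@?g e)) =>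
  refine (@pr_iter T g (fun y e => h e y) _ _ _); pr_tac
| |- pr (fun e => _ * _) => apply: pr_mul; pr_tac
| |- pr (fun e => _ + _) => apply: pr_add; pr_tac
| |- pr (fun e => _ ^ _) => apply: pr_exp; pr_tac
| |- pr (fun e => cpair _ _) => apply: pr_cpair; pr_tac
| |- pr (fun e => dig _ _ _) => apply: pr_dig; pr_tac
| |- pr (fun e => S _) => first [exact: pr_cst | apply: pr_succ; pr_tac]
| |- pr (fun e => nat_of_bool (@?b e)) => change (prb b); pr_tac
| |- pr (fun e => nth 0 (@?s e) 0) =>
  let rec go k := first [exact: (pr_nth_behead k) | go (S k)] in go 0
end.

Lemma decide_recursive :
  recursive (fun x : 1.-tuple nat => nat_of_bool (decide (thead x))).
Proof.
have pd : prb (fun e => decide (nth 0 e 0)).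
  by rewrite /decide /good_world /sign_bound; pr_tac.
by have := pd 1; congr recursive; apply/funext => x; rewrite /thead (tnth_nth 0).
Qed.

(** * Signs of integer linear forms *)

Section SignCell.
Local Open Scope ring_scope.

(* [z] occupies the same cell of the subdivision of the line by the points
   [m p] as [x] in the subdivision by the points [l p]. *)
Lemma same_cell (R : realFieldType) (T : finType) (p0 : T) (l : T -> R)
    (m : T -> rat) (x : R) :
  (forall p q, (l p < l q) = (m p < m q)) ->
  exists p q (e : int), (`|e| <= 1)%N /\
    let z := (m p + m q) / 2%:R + e%:~R in
    forall p', (l p' < x) = (m p' < z) /\ (x < l p') = (z < m p').
Proof.
move=> lm; have [[p /eqP lp]|/forallNP neq] := pselect (exists p, l p == x).
  exists p, p, 0; split=> //= p'; rewrite -lp !lm.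
  by have -> : (m p + m p) / 2%:R + 0%:~R = m p by lra.
have cmp p : (l p < x) || (x < l p) by rewrite -neq_lt; apply/negP/neq.
pose up p := x < l p; pose lo p := l p < x.
have lo_up p q : lo p -> up q -> m p < m q.
  by move=> lop upq; rewrite -lm; apply: lt_trans upq.
have lo_upF p : lo p -> up p -> False by move=> lop /(lo_up _ _ lop); rewrite ltxx.
have maxlo q : lo q -> exists2 p, lo p & forall p', lo p' -> m p' <= m p.
  by move=> loq; case: (arg_maxP m loq) => p; exists p.
have minup q : up q -> exists2 p, up p & forall p', up p' -> m p <= m p'.
  by move=> loq; case: (arg_minP m loq) => p; exists p.
have sol z : (forall p, lo p -> m p < z) -> (forall p, up p -> z < m p) ->
    forall p', lo p' = (m p' < z) /\ up p' = (z < m p').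
  move=> loz upz p; case/orP: (cmp p) => Hp.
    rewrite [lo p]Hp (loz _ Hp) (lt_gtF (loz _ Hp)); split=> //.
    by apply/negP => /(lo_upF _ Hp).
  rewrite [up p]Hp (upz _ Hp) (lt_gtF (upz _ Hp)); split=> //.
  by apply/negP => /lo_upF; apply.
(* If there are points on both sides, [z] is the midpoint of the greatest one below and the least
   one above; otherwise it lies one unit beyond the extreme point. *)
have [[p /maxlo[{}p lop maxp]]|noLo] := pselect (exists p, lo p).
  have [[q /minup[{}q upq minq]]|noUp] := pselect (exists q, up q).
    exists p, q, 0; split=> //; apply: sol => p' Hp'.
      by have := maxp _ Hp'; have := lo_up _ _ lop upq; lra.
    by have := minq _ Hp'; have := lo_up _ _ lop upq; lra.
  exists p, p, 1; split=> //; apply: sol => p' Hp'; last by case: noUp; exists p'.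
  by have := maxp _ Hp'; lra.
have up0 : up p0 by case/orP: (cmp p0) => // Hp; case: noLo; exists p0.
have [p upp minp] := minup _ up0.
exists p, p, (-1); split=> //; apply: sol => p' Hp'; first by case: noLo; exists p'.
by have := minp _ Hp'; lra.
Qed.

Definition dot (R : realFieldType) n (a : 'I_n -> int) (x : 'I_n -> R) : R :=
  \sum_i (a i)%:~R * x i.

Lemma dot_linear (R : realFieldType) n (c d : int) (a b : 'I_n -> int) (x : 'I_n -> R) :
  dot (fun i => c * a i + d * b i) x = c%:~R * dot a x + d%:~R * dot b x.
Proof.
rewrite /dot !mulr_sumr -big_split; apply: eq_bigr => i _ /=.
by rewrite intrD !intrM mulrDl !mulrA.
Qed.

Lemma dot_int n (a y : 'I_n -> int) :
  dot a (fun i => (y i)%:~R : rat) = (\sum_i a i * y i)%:~R.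
Proof. by rewrite /dot rmorph_sum /=; apply: eq_bigr => i _; rewrite intrM. Qed.

Lemma dot_bound n (a y : 'I_n -> int) K g :
  (forall i, (`|a i| <= K)%N) -> (forall i, (`|y i| <= g)%N) ->
  (`|(\sum_i a i * y i)%R| <= n * (K * g))%N.
Proof.
move=> aK yg; elim: n a y aK yg => [|n IH] a y aK yg; first by rewrite big_ord0.
rewrite big_ord_recl mulSn.
have := IH (fun i => a (lift ord0 i)) (fun i => y (lift ord0 i))
  (fun i => aK _) (fun i => yg _).
have : (`|(a ord0 * y ord0)%R| <= K * g)%N by rewrite abszM leq_mul.
by move=> /= h1 h2; apply: leq_trans (leq_add h1 h2); lia.
Qed.

(** A new coordinate multiplies the old ones by a common denominator of size at most 2K^2. The new
    one is the cleared midpoint of two quotients, shifted by at most one unit; a numerator is at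
    most [n' * (K * g)] when [g] bounds the old coordinates. *)
Fixpoint sign_bound_rec n K : nat :=
  if n is n'.+1 then
    (2 * (K * K) * (n' * (K * sign_bound_rec n' (2 * (K * K))) + 1))%N else 1%N.

Lemma sign_cell (R : realFieldType) n K (x : 'I_n -> R) : (0 < K)%N ->
  exists y : 'I_n -> int, (forall i, (`|y i| <= sign_bound_rec n K)%N) /\
    forall a : 'I_n -> int, (forall i, (`|a i| <= K)%N) ->
      (0 < dot a x) = (0 < \sum_i a i * y i).
Proof.
elim: n K x => [|n IH] K x K0.
  by exists (fun=> 0); split=> [[]//|a _]; rewrite /dot !big_ord0 !ltxx.
pose x' i := x (lift ord0 i); set K' := (2 * (K * K))%N.
have /(IH _ x')[y' [y'bound y'sign]] : (0 < K')%N by rewrite !muln_gt0 K0.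
set g := sign_bound_rec n K' in y'bound.
(* [T] enumerates the possible roots of the forms in the new coordinate: denominators from 1 to [K],
   numerators with coefficients from [-K] to [K], stored with offset [K]. *)
pose T : finType := ('I_K * {ffun 'I_n -> 'I_(2 * K).+1})%type.
pose den (p : T) : int := p.1.+1.
pose num (p : T) (i : 'I_n) : int := (p.2 i : nat)%:Z - K%:Z.
have den0 p : 0 < den p by [].
have denK p : (`|den p| <= K)%N by rewrite /den absz_nat; case: p.1.
have numK p i : (`|num p i| <= K)%N by rewrite /num; case: (p.2 i) => /= k; lia.
have surj (d : int) (a : 'I_n -> int) : 0 < d -> (`|d| <= K)%N ->
    (forall i, (`|a i| <= K)%N) -> exists p, den p = d /\ num p =1 a.
  case: d => // -[//|d] _ dK aK.
  exists (Ordinal dK, [ffun i => inord `|(a i + K%:Z)%R|%N]).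
  split=> // i; rewrite /num ffunE inordK.
    by have := aK i; lia.
  by have := aK i; lia.
pose yq i : rat := (y' i)%:~R.
have sgE (a : 'I_n -> int) : (forall i, (`|a i| <= K')%N) ->
    (0 < dot a x') = (0 < dot a yq).
  by move=> aK; rewrite y'sign // /yq dot_int ltr0z.
(* Cross-multiplying turns a comparison of two quotients into the sign of one form, with
   coefficients at most 2K^2, to which the induction hypothesis applies. *)
have dotK p q (F : realFieldType) (z : 'I_n -> F) :
    (dot (num p) z / (den p)%:~R < dot (num q) z / (den q)%:~R) =
    (0 < dot (fun i => den p * num q i + (- den q) * num p i) z).
  rewrite dot_linear ltr_pdivrMr ?ltr0z // mulrAC ltr_pdivlMr ?ltr0z //.
  by rewrite -subr_gt0 intrN mulNr ![(den _)%:~R * _]mulrC.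
have cells p q :
    (dot (num p) x' / (den p)%:~R < dot (num q) x' / (den q)%:~R) =
    (dot (num p) yq / (den p)%:~R < dot (num q) yq / (den q)%:~R).
  rewrite !dotK sgE // => i; rewrite /K'.
  have h (u v : int) : (`|u| <= K)%N -> (`|v| <= K)%N -> (`|(u * v)%R| <= K * K)%N.
    by move=> uK vK; rewrite abszM leq_mul.
  by have := h _ _ (denK p) (numK q i); have := h _ _ (denK q) (numK p i); lia.
have [p0 _] : exists p, den p = 1 /\ num p =1 (fun=> 0) by apply: surj.
have [p [q [e [e1 /= cell]]]] := same_cell p0 (x ord0) cells.
set z := _ + e%:~R in cell.
(* [Q] clears the denominators of [z], the factor 2 being that of the midpoint. Scaling all
   coordinates by the positive [Q] preserves signs. *)
pose Q := 2 * (den p * den q).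
pose Y := fun r : T => \sum_i num r i * y' i.
pose y0 := den q * Y p + den p * Y q + Q * e.
have Q0 : 0 < Q by rewrite !mulr_gt0.
have QK : (`|Q| <= K')%N.
  by rewrite /Q /K' !abszM leq_mul // leq_mul.
have zE : z * Q%:~R = y0%:~R.
  rewrite /z /y0 /Q /yq !dot_int -!/(Y _) !(intrD, intrM).
  by field; apply/andP; split; rewrite lt0r_neq0 ?ltr_pwDl.
pose y i := if unlift ord0 i is Some j then Q * y' j else y0.
have y0E : y ord0 = y0 by rewrite /y unlift_none.
have ySE i : y (lift ord0 i) = Q * y' i by rewrite /y liftK.
exists y; split.
  move=> i; case: (unliftP ord0 i) => [j|] ->.
    rewrite ySE abszM leq_mul //.
    apply: leq_trans (y'bound j) _; rewrite -/K' -/g mulnA.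
    apply: leq_trans (leq_addr _ _); rewrite leq_pmull // muln_gt0 K0.
    by case: (n) j => // -[].
  rewrite y0E; have Yb r : (`|Y r| <= n * (K * g))%N by apply: dot_bound.
  have := leq_mul (denK q) (Yb p); have := leq_mul (denK p) (Yb q).
  have := leq_mul QK e1; rewrite -!abszM.
  rewrite /= -/K' -/g /y0 /K'; move: (den q * Y p) (den p * Y q) (Q * e) => u v w.
  move=> h1 h2 h3; have : (`|(u + v + w)%R| <= `|u| + `|v| + `|w|)%N by lia.
  nia.
move=> a aK; pose a' i := a (lift ord0 i).
have sumE : \sum_i a i * y i = a ord0 * y0 + Q * \sum_i a' i * y' i.
  rewrite big_ord_recl y0E mulr_sumr; congr (_ + _).
  by apply: eq_bigr => i _; rewrite ySE mulrCA.
have a'K i : (`|a' i| <= K)%N by exact: aK.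
rewrite sumE /dot big_ord_recl -/(dot a' x').
have -> : (0 < a ord0 * y0 + Q * \sum_i a' i * y' i) =
    (0 < (a ord0)%:~R * z + dot a' yq).
  rewrite -(ltr0z rat) /yq dot_int intrD [X in X + _]intrM [X in _ + X]intrM -zE.
  by rewrite mulrA [Q%:~R * _]mulrC -mulrDl pmulr_lgt0 ?ltr0z.
have oppN (F : realFieldType) (u : 'I_n -> F) : dot (fun i => - a' i) u = - dot a' u.
  by rewrite /dot -sumrN; apply: eq_bigr => i _; rewrite intrN mulNr.
have eqdot (b b' : 'I_n -> int) (F : realFieldType) (u : 'I_n -> F) :
    b =1 b' -> dot b u = dot b' u.
  by move=> bb'; apply: eq_bigr => i _; rewrite bb'.
(* If the leading coefficient vanishes, the induction hypothesis decides. Otherwise the sign says on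
   which side of the root of the form the new coordinate lies, and that root is a quotient in
   [T]. *)
case: (ltrgt0P (a ord0)) => [a0|a0|->]; last first.
- rewrite !mul0r !add0r sgE // => i; apply: leq_trans (a'K i) _.
  by rewrite /K'; nia.
- have [r [dr nr]] : exists r, den r = - a ord0 /\ num r =1 a'.
    by apply: surj; rewrite ?oppr_gt0 // abszN.
  have [_] := cell r; rewrite !(eqdot _ _ _ _ nr) dr !ltr_pdivlMr ?ltr0z ?oppr_gt0 //.
  by rewrite -subr_gt0 -[RHS]subr_gt0 !intrN !mulrN !opprK
    ![_ + _ * _]addrC ![_%:~R * _]mulrC.
have [r [dr nr]] : exists r, den r = a ord0 /\ num r =1 (fun i => - a' i).
  by apply: surj => // i; rewrite abszN.
have [] := cell r; rewrite !(eqdot _ _ _ _ nr) !oppN dr !ltr_pdivrMr ?ltr0z //.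
by rewrite -subr_gt0 -[RHS]subr_gt0 !opprK ![_%:~R * _]mulrC.
Qed.

Lemma sign_bound_recE n K : (sign_bound_rec n K <= sign_bound n K)%N.
Proof.
rewrite /sign_bound; set M := iter n _ K.
(* The recursion changes its coefficient bound as it descends, so the induction covers every [k]
   whose [j]-fold iterate stays below [M]. *)
suff H j k : (iter j (fun k => 2 * (k * k)) k <= M)%N -> (j <= n)%N ->
    (sign_bound_rec j k <= iter j (fun g => 2 * (M * M) * (n * M * g + 1)) 1)%N.
  exact: H.
elim: j k => // j IH k; rewrite iterSr => leM lt_jn.
have kM : (k <= M)%N.
  apply: leq_trans leM; elim: (j) {IH lt_jn} => [|i IHi] /=; first by nia.
  by apply: leq_trans IHi _; nia.
have := IH _ leM (ltnW lt_jn); rewrite [sign_bound_rec _.+1 _]/= iterS.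
move: (sign_bound_rec _ _) (iter j _ _) => u v uv.
apply: leq_mul; first by rewrite leq_mul // leq_mul.
by rewrite leq_add2r mulnA !leq_mul // ltnW.
Qed.

End SignCell.

(** * Derivability *)

(** Infinitely branching well-founded proof trees stand in for transfinite sequences and give an
    induction principle on theorems. *)
Inductive provable (P : Type) : form P -> Prop :=
| pv_ax phi : axiom phi -> provable phi
| pv_mp phi psi : provable phi -> provable (Imp phi psi) -> provable psi
| pv_arch n (r : q01) phi psi :
    (forall s : q01, (val s < val r)%R ->
      provable (Imp psi (iter n (@Next P) (L s phi)))) ->
    provable (Imp psi (iter n (@Next P) (L r phi)))
| pv_nec_L phi : provable phi -> provable (L q1 phi)
| pv_nec_next phi : provable phi -> provable (Next phi).

Lemma follows_sub (P : Type) (G G' : form P -> Prop) phi :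
  (forall psi, G psi -> G' psi) -> follows G phi -> follows G' phi.
Proof.
move=> GG' [{}phi psi /GG' Gphi /GG' Gimp|n r {}phi psi GL|{}phi /GG' Gphi|{}phi /GG' Gphi].
- exact: r_mp Gphi Gimp.
- by apply: r_arch => s /GL/GG'.
- exact: r_nec_L.
- exact: r_nec_next.
Qed.

Lemma follows_provable (P : Type) (phi : form P) :
  follows (@provable P) phi -> provable phi.
Proof.
case=> [{}phi psi pv pvi|n r {}phi psi|{}phi|{}phi].
- exact: pv_mp pv pvi.
- exact: pv_arch.
- exact: pv_nec_L.
- exact: pv_nec_next.
Qed.

Lemma theorem_provable (P : Type) (phi : form P) : is_theorem phi -> provable phi.
Proof.
move=> [I [lt [d [[[wf_lt _ _] der] [l _ <-]]]]].
elim/(well_founded_ind wf_lt): l => i IH.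
case: (der i) => [|fol]; first exact: pv_ax.
by apply/follows_provable/(follows_sub _ fol) => psi [j /IH dj <-].
Qed.

(** * Concatenating countably many derivations *)

Section LexSum.
Variables (I : nat -> countType) (lt : forall n, I n -> I n -> Prop).

Definition lex (x y : {n : nat & I n}) :=
  (tag x < tag y) \/
  exists e : tag x = tag y, lt (eq_rect _ I (tagged x) _ e) (tagged y).

(** [None] is the position of a conclusion placed after the concatenated derivations of its
    premises. *)
Definition lex_top (x y : option {n : nat & I n}) :=
  match x, y with
  | Some x, Some y => lex x y
  | Some _, None => True
  | None, _ => False
  end.

Lemma lex_topP : (forall n, well_order (@lt n)) -> well_order lex_top.
Proof.
move=> wo_lt; have acc_Some x : Acc lex_top (Some x).
  case: x => n; elim/ltn_ind: n => n IHn a; have [wf_lt _ _] := wo_lt n.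
  elim/(well_founded_ind wf_lt): a => a IHa.
  constructor=> -[[m b]|[]] [/= mn|[/= e]]; first exact: IHn.
  by subst m; exact: IHa.
split.
- by move=> [x|]; first exact: acc_Some; constructor=> -[].
- move=> [[i a]|] [[j b]|] [[k c]|] //= [/= ij|[/= e ab]] [/= jk|[/= e' bc]].
  + by left; apply: ltn_trans jk.
  + by subst k; left.
  + by subst j; left.
  + subst j k; right; exists erefl; have [_ tr _] := wo_lt i; exact: tr bc.
move=> [[i a]|] [[j b]|] /=; last 1 [exact: Or32]; try by [exact: Or31|exact: Or33].
case: (ltngtP i j) => [ij|ji|e]; [by apply: Or31; left|by apply: Or33; left|].
subst j; have [_ _ tot] := wo_lt i; case: (tot a b) => [ab|->|ba].
- by apply: Or31; right; exists erefl.
- exact: Or32.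
- by apply: Or33; right; exists erefl.
Qed.

End LexSum.

(** The derivations of all [F n] are put one after another and [phi] on top. The index type is a
    countable sum with one added point, hence countable. *)
Lemma theorem_rule (P : Type) (F : nat -> form P) phi :
  (forall n, is_theorem (F n)) ->
  axiom phi \/ follows (fun psi => exists n, F n = psi) phi -> is_theorem phi.
Proof.
move=> thF; have /choice[D HD] : forall n, exists D : {I : countType &
    ((I -> I -> Prop) * (I -> form P))%type},
    derivation (tagged D).1 (tagged D).2 /\
    exists2 l, (forall i, i <> l -> (tagged D).1 i l) & (tagged D).2 l = F n.
  by move=> n; have [I [lt [d H]]] := thF n; exists (existT _ I (lt, d)).
move=> rule.
pose I n := tag (D n); pose lt n : I n -> I n -> Prop := (tagged (D n)).1.
pose d n : I n -> form P := (tagged (D n)).2.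
exists (option {n : nat & I n} : countType), (@lex_top I lt),
  (fun x => if x is Some y then d (tag y) (tagged y) else phi); split; last first.
  by exists None => // -[].
split; first by apply: lex_topP => n; have [[]] := HD n.
move=> [[n a]|] /=.
  have [[_ /(_ a)]] := HD n; case=> [ax _|fol _]; [by left|right].
  apply: follows_sub fol => psi [b ltb <-].
  by exists (Some (existT _ n b)) => //=; right; exists erefl.
case: rule => [|fol]; [by left|right].
apply: follows_sub fol => psi [n <-]; have [_ [l _ dl]] := HD n.
by exists (Some (existT _ n l)).
Qed.

Lemma provable_theorem (P : Type) (phi : form P) : provable phi -> is_theorem phi.
Proof.
have ax_thm psi : axiom psi -> is_theorem psi.
  move=> ax; exists unit, (fun _ _ => False), (fun=> psi); split; last first.
    by exists tt => // -[].
  split; last by left.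
  by split=> [x|//|[] []]; [constructor|apply: Or32].
elim=> {phi} [phi|phi psi _ th1 _ th2|n r phi psi _ IH|phi _ th|phi _ th].
- exact: ax_thm.
- apply: (theorem_rule (F := fun n => if n is 0 then phi else Imp phi psi)).
    by case.
  by right; apply: (r_mp (phi := phi)); [exists 0|exists 1].
- pose A s := Imp psi (iter n (@Next P) (L s phi)).
  have taut : is_theorem (Imp phi phi).
    by apply/ax_thm/ax_taut => v /=; case: bool_eval.
  (* The premises of the infinitary rule are enumerated through the countability of [q01]; indices
     that give no [s < r] are padded with a tautology. *)
  pose F k := if @unpickle q01 k is Some s
    then if (val s < val r)%R then A s else Imp phi phi else Imp phi phi.
  apply: (theorem_rule (F := F)).
    by rewrite /F => k; case: unpickle => // s; case: ifP => // /IH.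
  by right; apply: r_arch => s lt_sr; exists (pickle s); rewrite /F pickleK lt_sr.
- by apply: (theorem_rule (F := fun=> phi)) => //; right; apply: r_nec_L; exists 0.
- by apply: (theorem_rule (F := fun=> phi)) => //; right; apply: r_nec_next; exists 0.
Qed.

(** * Soundness in finite models *)

Section Soundness.
Variables (P : Type) (W : finType) (X : pred W) (mu : W -> W -> rat).
Variables (f : W -> W) (V : P -> W -> bool).
Local Open Scope ring_scope.

(** Truth is defined on all of [W], but the model proper is [X]: it is closed under [f], and at its
    states [mu] is a probability concentrated on [X]. *)
Fixpoint sem (phi : form P) (t : W) : bool :=
  match phi with
  | Var p => V p t
  | Neg psi => ~~ sem psi t
  | And psi chi => sem psi t && sem chi t
  | L r psi => val r <= \sum_(u | sem psi u) mu t u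
  | Next psi => sem psi (f t)
  end.

Lemma sem_bool_eval phi t : bool_eval (sem^~ t) phi = sem phi t.
Proof. by elim: phi => //= [phi ->|phi -> psi ->]. Qed.

Lemma sem_iter_Next n phi t : sem (iter n (@Next P) phi) t = sem phi (iter n f t).
Proof. by elim: n t => //= n IH t; rewrite IH -iterSr. Qed.

Lemma sem_Imp phi psi t : sem (Imp phi psi) t = (sem phi t ==> sem psi t).
Proof. by rewrite /= negb_and negbK implybE. Qed.

Hypothesis mu_ge0 : forall t u, 0 <= mu t u.
Hypothesis mu_sum : forall t, X t -> \sum_u mu t u = 1.
Hypothesis mu_supp : forall t u, X t -> ~~ X u -> mu t u = 0.
Hypothesis f_stable : forall t, X t -> X (f t).

Let mass A t := \sum_(u | sem A u) mu t u.

Lemma mass_split A B t : mass A t = mass (And A B) t + mass (And A (Neg B)) t.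
Proof. exact: bigID. Qed.

Lemma soundness phi : provable phi -> forall t, X t -> sem phi t.
Proof.
elim=> {phi} [phi ax|phi psi _ IH1 _ IH2|n r phi psi _ IH|phi _ IH|phi _ IH] t Xt.
- case: phi / ax => [phi taut|phi|r s phi rs|r s q phi psi qE|r s q phi psi qE
    |r phi psi|phi|phi psi].
  + by rewrite -sem_bool_eval.
  + by apply: sumr_ge0 => u _.
  + rewrite sem_Imp /=; apply/implyP => le_r; rewrite -ltNge.
    have := mu_sum Xt; rewrite (bigID (sem phi)) /=.
    by move: (\sum_(_ | _) _) (\sum_(_ | _) _) le_r => x y; move: rs => /=; lra.
  + rewrite sem_Imp; apply/implyP => /andP[h1 h2]; change (is_true (val q <= mass phi t)).
    by rewrite (mass_split _ psi) qE lerD.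
  + rewrite sem_Imp; apply/implyP => /andP[h1 h2].
    rewrite /= -/(mass phi t) (mass_split _ psi) qE -ltNge.
    by rewrite /= -!ltNge in h1 h2; apply: ltrD.
  + rewrite !sem_Imp; apply/implyP => h1; apply/implyP => h2.
    change (is_true (1 <= mass (Imp phi psi) t)) in h1.
    change (is_true (val r <= mass phi t)) in h2.
    change (is_true (val r <= mass psi t)); apply: le_trans h2 _.
    (* The implication has mass 1, so [And phi (Neg psi)] has mass 0 and the mass of [phi] is that
       of [And phi psi], at most that of [psi]. *)
    rewrite (mass_split phi psi).
    have := mass_split psi phi t.
    have -> : mass (And psi phi) t = mass (And phi psi) t.
      by apply: eq_bigl => u /=; rewrite andbC.
    have : mass (And psi (Neg phi)) t >= 0 by apply: sumr_ge0.
    have : mass (Imp phi psi) t + mass (And phi (Neg psi)) t = 1.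
      by rewrite addrC -(mu_sum Xt) [RHS](bigID (sem (And phi (Neg psi)))).
    lra.
  + by rewrite /Iff /=; case: sem.
  + by rewrite /Iff /=; case: sem; case: sem.
- by have := IH2 t Xt; rewrite sem_Imp IH1.
- rewrite sem_Imp sem_iter_Next; apply/implyP => psit.
  set t' := iter n f t; have Xt' : X t' by rewrite /t'; elim: (n) => //= k /f_stable.
  change (is_true (val r <= mass phi t')); rewrite leNgt; apply/negP => lt_r.
  have m0 : 0 <= mass phi t' by apply: sumr_ge0.
  have /andP[r0 r1] := valP r.
  (* The masses are rational, so the midpoint of the mass and [r] is an admissible index below [r];
     the premise for that index fails at [t]. *)
  have s01 : 0 <= (mass phi t' + val r) / 2 <= 1 by apply/andP; split; lra.
  pose q : q01 := exist (fun r : rat => 0 <= r <= 1) _ s01.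
  have mid : (mass phi t' + val r) / 2 < val r /\
    mass phi t' < (mass phi t' + val r) / 2 by lra.
  have := IH q mid.1 t Xt; rewrite sem_Imp psit sem_iter_Next.
  by apply/negP; rewrite -ltNge; exact: mid.2.
- change (is_true (1 <= mass phi t)); rewrite -(mu_sum Xt).
  rewrite /mass [leRHS]big_mkcond; apply: ler_sum => u _.
  by have [/IH ->|/(mu_supp Xt) ->] := boolP (X u); rewrite // if_same.
- exact/IH/f_stable.
Qed.

End Soundness.

(** * Canonical worlds *)

Section Worlds.
Variable P : countType.
Implicit Types (phi psi G : form P) (v : form P -> bool).

Lemma pv_taut phi : (forall v, bool_eval v phi) -> provable phi.
Proof. by move=> taut; apply/pv_ax/ax_taut. Qed.

Lemma pv_weaken phi psi : (forall v, bool_eval v phi -> bool_eval v psi) ->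
  provable phi -> provable psi.
Proof.
move=> taut pv; apply: pv_mp pv _; apply: pv_taut => v /=.
by rewrite negb_and negbK -implybE; apply/implyP/taut.
Qed.

Lemma pv_weaken2 phi phi' psi :
  (forall v, bool_eval v phi -> bool_eval v phi' -> bool_eval v psi) ->
  provable phi -> provable phi' -> provable psi.
Proof.
move=> taut pv pv'; apply: pv_mp pv' _; apply: pv_weaken pv => v vphi /=.
by rewrite negb_and negbK -implybE; apply/implyP/taut.
Qed.

Definition consistent G := ~ provable (Neg G).
Definition entails G phi := provable (Imp G phi).
Definition nextL n r phi := iter n (@Next P) (L r phi).

Lemma nextL_inj n r phi n' r' phi' :
  nextL n r phi = nextL n' r' phi' -> [/\ n = n', r = r' & phi = phi'].
Proof.
rewrite /nextL; elim: n n' => [|n IH] [|n'] //=; first by case.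
by case=> /IH[-> -> ->].
Qed.

(** [G] stands for a finite theory, as a conjunction. Rejecting the conclusion of the infinitary
    rule requires a witness: a premise that is rejected too. *)
Definition saturated_for G phi := entails G phi \/ entails G (Neg phi) /\
  forall n (r : q01) psi, phi = nextL n r psi ->
    exists2 s : q01, (val s < val r)%R & entails G (Neg (nextL n s psi)).

Lemma entails_refl G : entails G G.
Proof. by apply: pv_taut => v /=; rewrite andbN. Qed.

Lemma entails_and1 G G' : entails (And G G') G.
Proof. by apply: pv_taut => v /=; rewrite andbAC andbN. Qed.

Lemma entails_and2 G G' : entails (And G G') G'.
Proof. by apply: pv_taut => v /=; rewrite -andbA andbN andbF. Qed.

Lemma entails_trans phi psi chi : entails phi psi -> entails psi chi -> entails phi chi.
Proof.
by apply: pv_weaken2 => v /=; case: (bool_eval v phi) (bool_eval v psi) => [] [].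
Qed.

Lemma entailsF G phi : consistent G -> entails G phi -> entails G (Neg phi) -> False.
Proof.
move=> conG e e'; apply: conG; apply: pv_weaken2 e e' => v /=.
by case: (bool_eval v G); case: (bool_eval v phi).
Qed.

Lemma inconsistent_and G phi :
  ~ consistent (And G phi) -> entails G (Neg phi).
Proof.
move=> /contrapT; apply: pv_weaken => v /=.
by case: (bool_eval v G); case: (bool_eval v phi).
Qed.

Lemma saturation_step G n : consistent G -> exists G', [/\ consistent G',
  entails G' G & forall phi, code phi = n -> saturated_for G' phi].
Proof.
move=> conG; have [[phi codephi]|nophi] := pselect (exists phi, code phi = n); last first.
  by exists G; split=> // [|phi codephi]; [exact: entails_refl|case: nophi; exists phi].
suff [G' [conG' entG' sat]] : exists G',
    [/\ consistent G', entails G' G & saturated_for G' phi].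
  by exists G'; split=> // psi; rewrite -codephi => /code_inj ->.
have [con|/inconsistent_and ent] := pselect (consistent (And G phi)).
  exists (And G phi); split=> //; first exact: entails_and1.
  by left; exact: entails_and2.
pose H := And G (Neg phi); have conH : consistent H.
  move=> pv; apply: (entailsF conG) ent; move: pv; apply: pv_weaken => v /=.
  by case: (bool_eval v G); case: (bool_eval v phi).
have HG : entails H G by exact: entails_and1.
have Hphi : entails H (Neg phi) by exact: entails_and2.
have [[k [r [psi phiE]]]|notL] := pselect (exists k r psi, phi = nextL k r psi);
  last first.
  exists H; split=> //; right; split=> // k r psi phiE.
  by case: notL; exists k, r, psi.
have [[s lt_sr con]|nos] := pselect (exists2 s : q01, (val s < val r)%R
    & consistent (And H (Neg (nextL k s psi)))).
  have eH := entails_and1 H (Neg (nextL k s psi)).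
  exists (And H (Neg (nextL k s psi))); split=> //; first exact: entails_trans HG.
  right; split; first exact: entails_trans Hphi.
  move=> k' r' psi'; rewrite phiE => /nextL_inj[<- <- <-].
  by exists s => //; exact: entails_and2.
(* If no witness is consistent with [H], then [H] entails every premise of the infinitary rule,
   hence also [phi], which it rejects. *)
case: (entailsF conH _ Hphi); rewrite phiE; apply: pv_arch => s lt_sr.
have /inconsistent_and : ~ consistent (And H (Neg (nextL k s psi))).
  by move=> con; apply: nos; exists s.
by apply: pv_weaken => v /=; rewrite negbK.
Qed.

(* Worlds are maximal consistent theories, given by their truth values on the
   atoms, that are moreover closed under the infinitary rule. *)
Definition world v := (forall phi, provable phi -> bool_eval v phi) /\
  forall n (r : q01) phi, ~~ bool_eval v (nextL n r phi) ->
    exists2 s : q01, (val s < val r)%R & ~~ bool_eval v (nextL n s phi).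

(** Stage [n] settles the formula with code [n]. The union [T] of the stages stays consistent
    because each entailment occurs at a finite stage, and the witnesses added on the way close it
    under the infinitary rule. *)
Lemma lindenbaum phi0 : consistent phi0 -> exists2 v, world v & bool_eval v phi0.
Proof.
move=> con0; have /choice[f fP] : forall p : nat * form P, exists G',
    consistent p.2 -> [/\ consistent G', entails G' p.2
      & forall phi, code phi = p.1 -> saturated_for G' phi].
  move=> [n G]; have [/(saturation_step n)[G' ?]|?] := pselect (consistent G).
    by exists G'.
  by exists G.
pose Gs := fix Gs n := if n is n'.+1 then f (n', Gs n') else phi0.
have conGs n : consistent (Gs n) by elim: n => //= n /(fP (n, _))[].
have stepGs n := fP (n, Gs n) (conGs n).
have entGs m n : m <= n -> entails (Gs n) (Gs m).
  move=> /subnK <-; elim: (n - m) => [|k IH]; first exact: entails_refl.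
  by apply: entails_trans IH; rewrite addSn; case: (stepGs (k + m)).
pose T phi := exists n, entails (Gs n) phi.
have T2 phi psi chi : T phi -> T psi ->
    (forall v, bool_eval v phi -> bool_eval v psi -> bool_eval v chi) -> T chi.
  move=> [m em] [n en] taut; exists (maxn m n).
  have em' := entails_trans (entGs _ _ (leq_maxl m n)) em.
  have en' := entails_trans (entGs _ _ (leq_maxr m n)) en.
  apply: pv_weaken2 em' en' => v /=; have := taut v.
  by case: (bool_eval v phi); case: (bool_eval v psi); case: (bool_eval v chi);
    case: (bool_eval v (Gs _)) => //= H; apply: H.
have TnegF phi : T phi -> T (Neg phi) -> False.
  move=> [m em] [n en]; apply: (entailsF (conGs (maxn m n)) (phi := phi)).
    exact: entails_trans (entGs _ _ (leq_maxl m n)) em.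
  exact: entails_trans (entGs _ _ (leq_maxr m n)) en.
have satT phi : T phi \/ T (Neg phi) /\ forall n (r : q01) psi, phi = nextL n r psi ->
    exists2 s : q01, (val s < val r)%R & T (Neg (nextL n s psi)).
  have [_ _ /(_ phi erefl)[e|[e sat]]] := stepGs (code phi).
    by left; exists (code phi).+1; exact: e.
  right; split; first by exists (code phi).+1; exact: e.
  by move=> n r psi /sat[s lt_sr es]; exists s => //; exists (code phi).+1; exact: es.
pose v phi := `[< T phi >].
have vT phi : bool_eval v phi = `[< T phi >].
  elim: phi => [p|phi IH|phi IHphi psi IHpsi|r phi _|phi _] //=;
    rewrite ?IH ?IHphi ?IHpsi.
    rewrite -asbool_neg; apply: asbool_equiv_eq.
    split=> [nT|Tn Tp]; last exact: TnegF Tp Tn.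
    by case: (satT phi) => [/nT|[]].
  rewrite -asbool_and; apply: asbool_equiv_eq; split=> [[Tphi Tpsi]|Tand].
    by apply: T2 Tphi Tpsi _ => u /= -> ->.
  by split; apply: (T2 _ _ _ Tand Tand) => u /= /andP[].
exists v; last by rewrite vT; apply/asboolP; exists 0; exact: entails_refl.
split=> [phi pv|n r phi].
  rewrite vT; apply/asboolP; exists 0; apply: pv_weaken pv => u /= ->.
  by rewrite andbF.
rewrite vT => /asboolPn nT; case: (satT (nextL n r phi)) => // -[_ /(_ _ _ _ erefl)].
by case=> s lt_sr Ts; exists s => //; rewrite vT; apply/asboolPn => /TnegF; apply.
Qed.

End Worlds.

(** * The finitely additive probability of a world *)

Section WorldMeasure.
Variables (R : realType) (P : countType).
Implicit Types (phi psi A B : form P) (v : form P -> bool).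
Local Open Scope ring_scope.

(** Lets derivability be checked by evaluating in all worlds; a formula not provable has a
    consistent negation, hence a refuting world. *)
Lemma provable_valid A : (forall v, world v -> bool_eval v A) -> provable A.
Proof.
move=> valA; apply: contrapT => npv; have [|v wv /=] := @lindenbaum _ (Neg A).
  by move=> pv; apply: npv; apply: pv_weaken pv => v /=; rewrite negbK.
by rewrite valA.
Qed.

Lemma q01_of (q : rat) : 0 <= q <= 1 -> exists q' : q01, val q' = q.
Proof. by move=> q01q; exists (exist (fun r : rat => 0 <= r <= 1) q q01q). Qed.

Definition next_world v := fun phi => v (Next phi).

Lemma bool_eval_Imp v A B : bool_eval v (Imp A B) = (bool_eval v A ==> bool_eval v B).
Proof. by rewrite /= negb_and negbK implybE. Qed.

Lemma bool_eval_Iff v A B : bool_eval v (Iff A B) = (bool_eval v A == bool_eval v B).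
Proof. by rewrite /=; case: bool_eval; case: bool_eval. Qed.

Lemma bool_eval_next v phi : world v -> bool_eval (next_world v) phi = v (Next phi).
Proof.
case=> thv _; elim: phi => //= [phi ->|phi -> psi ->].
  by have /thv := pv_ax (ax_next_neg phi); rewrite bool_eval_Iff => /eqP /= ->.
by have /thv := pv_ax (ax_next_and phi psi); rewrite bool_eval_Iff => /eqP /= ->.
Qed.

(** The infinitary rule under [n] occurrences of [Next] in the successor is the rule under [n.+1] in
    [v]; this is why the rule is stated for iterates of [Next]. *)
Lemma next_worldP v : world v -> world (next_world v).
Proof.
move=> wv; have [thv satv] := wv; split=> [phi pv|n r phi].
  by rewrite bool_eval_next //; apply: (thv (Next phi)); exact: pv_nec_next.
rewrite bool_eval_next // => /(satv n.+1)[s lt_sr nv].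
by exists s => //; rewrite bool_eval_next.
Qed.

Section Fixed.
Variables (v : form P -> bool) (wv : world v).

Lemma world_axiom phi : axiom phi -> bool_eval v phi.
Proof. by move=> ax; case: wv => thv _; apply/thv/pv_ax. Qed.

Lemma world_L1 A : (forall u, world u -> bool_eval u A) -> v (L q1 A).
Proof. by case: wv => thv _ /provable_valid/pv_nec_L/thv. Qed.

Lemma world_L_mono (r : q01) A B :
  (forall u, world u -> bool_eval u A -> bool_eval u B) -> v (L r A) -> v (L r B).
Proof.
move=> AB; have := world_axiom (ax_mono r A B); rewrite !bool_eval_Imp.
suff -> : bool_eval v (L q1 (Imp A B)) by move=> /= /implyP.
by apply: world_L1 => u wu; rewrite bool_eval_Imp; apply/implyP/AB.
Qed.

Lemma world_L_neg (r s : q01) A : 1 < val r + val s -> v (L r (Neg A)) -> ~~ v (L s A).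
Proof.
by move=> rs; have := world_axiom (ax_neg A rs); rewrite bool_eval_Imp => /implyP.
Qed.

Lemma world_L_add (r s t : q01) A B : val t = val r + val s ->
  v (L r (And A B)) -> v (L s (And A (Neg B))) -> v (L t A).
Proof.
move=> tE; have := world_axiom (ax_add A B tE); rewrite bool_eval_Imp.
by move=> /implyP /= H h1 h2; apply: H; rewrite h1.
Qed.

Lemma world_L_sub (r s t : q01) A B : val t = val r + val s ->
  ~~ v (L r (And A B)) -> ~~ v (L s (And A (Neg B))) -> ~~ v (L t A).
Proof.
move=> tE; have := world_axiom (ax_sub A B tE); rewrite bool_eval_Imp.
by move=> /implyP /= H h1 h2; apply: H; rewrite h1.
Qed.

Lemma world_L0 A : v (L q0 A).
Proof.
apply: (@world_L_mono q0 (Bot A)) => [u _ /=|]; first by rewrite andbN.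
exact: (world_axiom (ax_zero A)).
Qed.

Lemma world_L_bot (r : q01) A : 0 < val r -> ~~ v (L r (Bot A)).
Proof.
move=> r0; apply: (@world_L_neg q1); first by rewrite /= ltrDl.
by apply: world_L1 => u _ /=; rewrite andbN.
Qed.

(** Contrapositively, split [A] by [A] itself: if [L s] fails for [And A A], and [L] with index r -
    s fails for the contradiction [And A (Neg A)], then [world_L_sub] refutes [L r A]. *)
Lemma world_L_down (r s : q01) A : val s <= val r -> v (L r A) -> v (L s A).
Proof.
rewrite le_eqVlt => /predU1P[/val_inj -> //|lt_sr]; apply: contraTT => nv.
have /andP[s0 _] := valP s; have /andP[_ r1] := valP r.
have [q qE] : exists q : q01, val q = val r - val s.
  by apply: q01_of; rewrite subr_ge0 ltW //= lerBlDr ler_wpDr.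
apply: (@world_L_sub s q r A A); rewrite ?qE ?subrKC //.
  by apply: contra nv; apply: world_L_mono => u _ /= /andP[].
by apply: world_L_bot; rewrite qE subr_gt0.
Qed.

Definition mu A : R := sup [set x | exists2 q : q01, v (L q A) & x = ratr (val q)].

(** From right to left this is closure under the infinitary rule: if [L q A] fails, then [L s A]
    already fails for some [s < q], which bounds the supremum. *)
Lemma muP (q : q01) A : v (L q A) = (ratr (val q) <= mu A).
Proof.
apply/idP/idP => [vq|].
  apply: ub_le_sup; last by exists q.
  exists 1 => x [s _ ->]; rewrite -(rmorph1 (@ratr R)) ler_rat.
  by case/andP: (valP s).
apply: contraLR => nv; rewrite -ltNge.
have [_ /(_ 0%N q A nv)[s lt_sq ns]] := wv.
apply: (@le_lt_trans _ _ (ratr (val s))); last by rewrite ltr_rat.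
apply: ge_sup; first by exists (ratr 0), q0 => //; exact: world_L0.
move=> x [t vt ->]; rewrite ler_rat leNgt; apply: contra ns => /ltW le_st.
exact: world_L_down le_st vt.
Qed.

Lemma mu_ge0 A : 0 <= mu A.
Proof. by have := world_L0 A; rewrite muP /= rmorph0. Qed.

Lemma mu_le1 A : mu A <= 1.
Proof.
apply: ge_sup; first by exists (ratr 0), q0 => //; exact: world_L0.
move=> x [t vt ->]; rewrite -(rmorph1 (@ratr R)) ler_rat; by case/andP: (valP t).
Qed.

Lemma mu_mono A B : (forall u, world u -> bool_eval u A -> bool_eval u B) -> mu A <= mu B.
Proof.
move=> AB; apply: ge_sup; first by exists (ratr 0), q0 => //; exact: world_L0.
by move=> x [t vt ->]; rewrite -muP; apply: world_L_mono vt.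
Qed.

Lemma mu_ext A B : (forall u, world u -> bool_eval u A = bool_eval u B) -> mu A = mu B.
Proof. by move=> AB; apply/eqP; rewrite eq_le !mu_mono // => u /AB ->. Qed.

Lemma mu1 A : (forall u, world u -> bool_eval u A) -> mu A = 1.
Proof.
by move=> /world_L1; rewrite muP /= rmorph1 => le1; apply/eqP; rewrite eq_le mu_le1.
Qed.

Lemma mu_split A B : mu A = mu (And A B) + mu (And A (Neg B)).
Proof.
set a := mu A; set b := mu _; set c := mu (And A (Neg B)).
have a1 : a <= 1 := mu_le1 _.
have b0 : 0 <= b := mu_ge0 _.
have c0 : 0 <= c := mu_ge0 _.
have q01R (q : rat) : 0 <= ratr q :> R -> ratr q <= 1 :> R -> exists q' : q01, val q' = q.
  by move=> ge0 le1; apply: q01_of; rewrite -!(ler_rat R) rmorph0 rmorph1 ge0 le1.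
apply/eqP; rewrite eq_le; apply/andP; split; rewrite leNgt; apply/negP => lt.
  (* If b + c < a, rationals slightly above [b] and [c] have a sum below [a], against
     [world_L_sub]. *)
  have [|q] := @rat_in_itvoo _ b (b + (a - (b + c)) / 2%:R); first by lra.
  have [|r] := @rat_in_itvoo _ c (c + (a - (b + c)) / 2%:R); first by lra.
  rewrite !in_itv /= => /andP[cr rc] /andP[bq qb].
  have [q' qE] : exists q' : q01, val q' = q by apply: q01R; lra.
  have [r' rE] : exists r' : q01, val r' = r by apply: q01R; lra.
  have [t tE] : exists t : q01, val t = q + r by apply: q01R; rewrite rmorphD /=; lra.
  have : ~~ v (L t A).
    apply: (@world_L_sub q' r' t A B); rewrite ?tE ?qE ?rE // muP -ltNge.
      by rewrite qE.
    by rewrite rE.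
  by rewrite muP tE rmorphD /= -ltNge -/a; lra.
(* If a < b + c, rationals slightly below [b] and [c] have a sum above [a], against [world_L_add].
   When [x] is 0 the index is 0 itself, as no smaller one exists. *)
have below x : 0 <= x <= 1 -> exists2 q : q01, ratr (val q) <= x &
    x - (b + c - a) / 2%:R < ratr (val q).
  move=> /andP[x0 x1]; have [|lt0x] := leP x 0.
    by exists q0; rewrite /= rmorph0 //; lra.
  have [|q] := @rat_in_itvoo _ (Num.max 0 (x - (b + c - a) / 2%:R)) x.
    by rewrite gt_max lt0x; lra.
  rewrite in_itv /= gt_max => /andP[/andP[q0' ltq] qx].
  have [q' qE] : exists q' : q01, val q' = q by apply: q01R; lra.
  by exists q'; rewrite qE //; lra.
have [q qb bq] := below b ltac:(by rewrite b0 mu_le1).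
have [r rc cr] := below c ltac:(by rewrite c0 mu_le1).
have vq : v (L q (And A B)) by rewrite muP.
have vr : v (L r (And A (Neg B))) by rewrite muP.
have [le1|gt1] := leP (val q + val r) 1; last first.
  (* A sum above 1 is not an index; the two events being disjoint, [world_L_neg] excludes it. *)
  have h : v (L r (Neg (And A B))).
    by apply: world_L_mono vr => u _ /= /andP[_ /negPf ->]; rewrite andbF.
  by have := @world_L_neg r q (And A B); rewrite addrC vq => /(_ gt1 h).
have /andP[qq0 _] := valP q; have /andP[rr0 _] := valP r.
have [t tE] : exists t : q01, val t = val q + val r.
  by apply: q01_of; rewrite le1 addr_ge0.
by have := world_L_add tE vq vr; rewrite muP tE rmorphD /= -/a; lra.
Qed.

Lemma mu0 A : (forall u, world u -> ~~ bool_eval u A) -> mu A = 0.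
Proof.
move=> A0; have top u : world u -> bool_eval u (Neg A) by move=> /A0.
have := mu_split (Neg A) A; rewrite (mu1 top).
rewrite (@mu_ext (And (Neg A) A) A) => [|u /A0 /negPf /= ->] //.
by rewrite (@mu1 (And (Neg A) (Neg A))) => [|u /A0 /= ->] //; lra.
Qed.

End Fixed.
End WorldMeasure.

(** * Digits *)

Fixpoint digits n B (g : nat -> nat) :=
  if n is n'.+1 then g 0 + B * digits n' B (fun i => g i.+1) else 0.

Lemma digits_lt n B g : (forall i, i < n -> g i < B) -> digits n B g < B ^ n.
Proof.
elim: n g => // n IH g gB /=; rewrite expnS.
have := IH (fun i => g i.+1) (fun i => gB i.+1); have := gB 0 isT.
move=> g0 lt_d; apply: (@leq_trans (B * (digits n B (fun i => g i.+1)).+1)).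
  by rewrite mulnS ltn_add2r.
by rewrite leq_mul2l lt_d orbT.
Qed.

Lemma digS B w i : 0 < B -> dig B w i.+1 = dig B (w %/ B) i.
Proof. by move=> B0; rewrite /dig expnS divnMA. Qed.

Lemma dig_digits n B g i : (forall i, i < n -> g i < B) -> i < n ->
  dig B (digits n B g) i = g i.
Proof.
elim: n g i => // n IH g i gB lt_in; have g0 := gB 0 isT.
have B0 : 0 < B by exact: leq_trans g0.
case: i lt_in => [_|i lt_in] /=.
  by rewrite /dig expn0 divn1 addnC mulnC modnMDl modn_small.
rewrite digS // addnC mulnC divnMDl // divn_small // addn0 IH // => j.
exact: (gB j.+1).
Qed.

Lemma dig_inj n B w w' : 0 < B -> w < B ^ n -> w' < B ^ n ->
  (forall i, i < n -> dig B w i = dig B w' i) -> w = w'.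
Proof.
move=> B0; elim: n w w' => [|n IH] w w' ltw ltw' eqd.
  by move: ltw ltw'; rewrite !ltnS !leqn0 => /eqP-> /eqP->.
rewrite (divn_eq w B) (divn_eq w' B); congr (_ * B + _).
  by apply: IH => [||i lt_in]; rewrite ?ltn_divLR -?expnSr // -!digS // eqd.
by have := eqd 0 isT; rewrite /dig !expn0 !divn1.
Qed.

Definition bits n (b : nat -> bool) := digits n 2 (fun i => b i).

Lemma bits_lt n b : bits n b < 2 ^ n.
Proof. by apply: digits_lt => i _; rewrite ltnS leq_b1. Qed.

Lemma bit_bits n b i : i < n -> bit i (bits n b) = b i.
Proof.
by move=> lt_in; rewrite /bit dig_digits // => [|j _]; [case: (b i)|rewrite ltnS leq_b1].
Qed.

Lemma bit_lt n w i : w < 2 ^ n -> bit i w -> i < n.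
Proof.
move=> ltw; rewrite ltnNge; apply: contraL => le_ni.
by rewrite /bit /dig divn_small // (leq_trans ltw) // leq_exp2l.
Qed.

Lemma bit_inj n w w' : w < 2 ^ n -> w' < 2 ^ n ->
  (forall i, i < n -> bit i w = bit i w') -> w = w'.
Proof.
move=> ltw ltw' eqb; apply: (dig_inj (n := n) (B := 2)) => // i /eqb.
by rewrite /bit /dig !modn2; case: odd; case: odd.
Qed.

(** * Codes *)

Lemma cpair_ger x y : y <= cpair x y.
Proof. exact: leq_addl. Qed.

Lemma cpair_gel x y : x <= cpair x y.
Proof.
rewrite /cpair; case: x => // x; apply: leq_trans (leq_addr _ _).
have : (x.+1).*2 <= (x.+1 + y) * (x.+1 + y).+1 by rewrite -mul2n mulnC leq_mul //; lia.
by move/half_leq; rewrite doubleK.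
Qed.

Section Codes.
Variable P : countType.
Implicit Types phi psi : form P.

Lemma code_Neg phi x : code phi = cpair 1 x ->
  exists2 psi, phi = Neg psi & code psi = x.
Proof. by case: phi => [p|f|f g|r f|f] /= /cpair_inj[] // _ <-; exists f. Qed.

Lemma code_And phi x y : code phi = cpair 2 (cpair x y) ->
  exists psi chi, [/\ phi = And psi chi, code psi = x & code chi = y].
Proof.
by case: phi => [p|f|f g|r f|f] /= /cpair_inj[] // _ /cpair_inj[<- <-]; exists f, g.
Qed.

Lemma code_L phi a b x : code phi = cpair 3 (cpair (cpair a b) x) ->
  exists (r : q01) psi, [/\ phi = L r psi, `|numq (val r)|%N = a, `|denq (val r)|%N = b
    & code psi = x].
Proof.
case: phi => [p|f|f g|r f|f] /= /cpair_inj[] // _ /cpair_inj[/cpair_inj[<- <-] <-].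
by exists r, f.
Qed.

Lemma code_Next phi x : code phi = cpair 4 x ->
  exists2 psi, phi = Next psi & code psi = x.
Proof. by case: phi => [p|f|f g|r f|f] /= /cpair_inj[] // _ <-; exists f. Qed.

Lemma q01_frac (r : q01) :
  (val r = `|numq (val r)|%N%:R / `|denq (val r)|%N%:R /\
   0 < `|denq (val r)|%N%:R :> rat)%R.
Proof.
have /andP[r0 _] := valP r.
rewrite !pmulrn !gez0_abs ?numq_ge0 ?denq_ge0 //; split; first by rewrite divq_num_den.
by rewrite ltr0z denq_gt0.
Qed.

End Codes.

Lemma good_worldP c C X s :
  let N := 2 ^ c.+1 in
  let B := (sign_bound N c.+1).+1 in
  reflect
    [/\ forall x, x <= c -> bit (cpair 1 x) C ->
          bit x C /\ bit (cpair 1 x) s = ~~ bit x s,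
        forall x y, x <= c -> y <= c -> bit (cpair 2 (cpair x y)) C ->
          [/\ bit x C, bit y C
            & bit (cpair 2 (cpair x y)) s = bit x s && bit y s],
        exists s', [/\ s' < N, bit s' X & forall x, x <= c -> bit (cpair 4 x) C ->
          bit x C /\ bit (cpair 4 x) s = bit x s']
      & exists w, [/\ w < B ^ N, forall t, t < N -> 0 < dig B w t -> bit t X,
          0 < \sum_(0 <= t < N) dig B w t
        & forall a b x, a <= c -> b <= c -> x <= c ->
          bit (cpair 3 (cpair (cpair a b) x)) C ->
          bit x C /\ bit (cpair 3 (cpair (cpair a b) x)) s =
            (a * \sum_(0 <= t < N) dig B w t <=
             b * \sum_(0 <= t < N) bit x t * dig B w t)]]
    (good_world c C X s).
Proof.
move=> N B; rewrite /good_world; apply: (iffP and4P) => -[h1 h2 h3 h4]; split.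
- move=> x lex; move/ballP/(_ x lex)/implyP: h1 => h /h /andP[-> /eqP ->] //.
- move=> x y lex ley; move/ballP/(_ x lex)/ballP/(_ y ley)/implyP: h2 => h.
  by move/h => /and3P[-> -> /eqP ->].
- have [s' lts' /andP[s'X /ballP h]] := bexP _ _ h3; exists s'; split=> // x lex.
  by move/implyP: (h x lex) => h' /h' /andP[-> /eqP ->].
- have [w ltw /and3P[/ballP wX w0 /ballP h]] := bexP _ _ h4; exists w; split=> //.
    by move=> t ltt; apply/implyP/wX.
  move=> a b x lea leb lex; move/ballP/(_ b leb)/ballP/(_ x lex)/implyP: (h a lea).
  by move=> h' /h' /andP[-> /eqP ->].
- apply/ballP => x lex; apply/implyP => /(h1 x lex)[-> ->] /=; exact: eqxx.
- apply/ballP => x lex; apply/ballP => y ley; apply/implyP => /(h2 x y lex ley)[-> -> ->].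
  exact: eqxx.
- have [s' [lts' s'X h]] := h3; apply/bexP; exists s' => //; rewrite s'X /=.
  by apply/ballP => x lex; apply/implyP => /(h x lex)[-> ->] /=.
have [w [ltw wX w0 h]] := h4; apply/bexP; exists w => //; rewrite -/N -/B w0 /=.
apply/andP; split; first by apply/ballP => t ltt; apply/implyP/wX.
apply/ballP => a lea; apply/ballP => b leb; apply/ballP => x lex.
by apply/implyP => /(h a b x lea leb lex)[-> ->] /=.
Qed.

(** * Correctness of the decision procedure *)

Section Decide.
Variable P : countType.
Implicit Types phi psi : form P.

Section FromGood.
Variables (c C X : nat).
Let N := 2 ^ c.+1.
Let B := (sign_bound N c.+1).+1.
Hypotheses (ltC : C < 2 ^ c.+1) (good : forall s, s < N -> bit s X -> good_world c C X s).
Local Open Scope ring_scope.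

(** The successors and weights found by the searches are chosen at each state of [X], arbitrarily
    elsewhere, and the weights are divided by their total. The last clause is the truth lemma, by
    induction on the formula. *)
Lemma good_model : exists (mu : 'I_N -> 'I_N -> rat) (f : 'I_N -> 'I_N),
  [/\ forall t u, 0 <= mu t u,
      forall t : 'I_N, bit t X -> \sum_u mu t u = 1,
      forall t u : 'I_N, bit t X -> ~~ bit u X -> mu t u = 0,
      forall t : 'I_N, bit t X -> bit (f t) X
    & forall psi, bit (code psi) C -> forall t : 'I_N, bit t X ->
        sem mu f (fun p t => bit (code (Var p)) t) psi t = bit (code psi) t].
Proof.
have goodP (t : 'I_N) (tX : bit t X) := elimT (good_worldP _ _ _ _) (good (ltn_ord t) tX).
have /choice[f fP] : forall t : 'I_N, exists s' : 'I_N, bit t X ->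
    bit s' X /\ forall x, (x <= c)%N -> bit (cpair 4 x) C ->
          bit x C /\ bit (cpair 4 x) t = bit x s'.
  move=> t; case: (boolP (bit t X)) => [|_]; last by exists t.
  move=> /goodP[_ _ [s' [lts' s'X h]] _].
  by exists (Ordinal lts').
have /choice[w wP] : forall t : 'I_N, exists w, bit t X ->
    [/\ forall u, (u < N)%N -> (0 < dig B w u)%N -> bit u X,
          (0 < \sum_(0 <= u < N) dig B w u)%N
        & forall a b x, (a <= c)%N -> (b <= c)%N -> (x <= c)%N ->
          bit (cpair 3 (cpair (cpair a b) x)) C ->
          bit x C /\ bit (cpair 3 (cpair (cpair a b) x)) t =
            (a * \sum_(0 <= u < N) dig B w u <=
             b * \sum_(0 <= u < N) bit x u * dig B w u)%N].
  move=> t; case: (boolP (bit t X)) => [|_]; last by exists 0%N.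
  move=> /goodP[_ _ _ [w [_ wX w0 h]]].
  by exists w.
pose S t := (\sum_(0 <= u < N) dig B (w t) u)%N.
pose mu t u : rat := (dig B (w t) u)%:R / (S t)%:R.
exists mu, f; split.
- by move=> t u; rewrite divr_ge0.
- move=> t /wP[_ S0 _]; rewrite -mulr_suml -natr_sum.
  rewrite -(big_mkord xpredT (dig B (w t))) divff //.
  by rewrite pnatr_eq0 -lt0n.
- move=> t u /wP[wX _ _]; apply: contraNeq.
  rewrite mulf_eq0 negb_or pnatr_eq0 => /andP[+ _].
  by rewrite -lt0n; apply: wX.
- by move=> t /fP[].
have le_c x : bit x C -> (x <= c)%N by move/(bit_lt ltC).
have leI x y : (cpair x y <= c)%N -> (x <= c)%N /\ (y <= c)%N.
  by move=> le; rewrite (leq_trans (cpair_gel x y) le) (leq_trans (cpair_ger x y) le).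
elim=> [p|phi IH|phi IH1 psi IH2|r phi IH|phi IH] //= codeC t tX;
  have /leI[_ le] := le_c _ codeC.
- have [/(_ _ le codeC)[phiC ->] _ _ _] := goodP t tX.
  by rewrite (IH phiC).
- have /leI[le1 le2] := le.
  have [_ /(_ _ _ le1 le2 codeC)[phiC psiC ->] _ _] := goodP t tX.
  by rewrite IH1 ?IH2.
- have /leI[/leI[lea leb] lex] := le.
  have [wX S0 /(_ _ _ _ lea leb lex codeC)[phiC ->]] := wP t tX.
  have {}IH := IH phiC; set A := sem mu f _ phi in IH *.
  have -> : \sum_(u | A u) mu t u =
      (\sum_(0 <= u < N) bit (code phi) u * dig B (w t) u)%N%:R / (S t)%:R.
    rewrite big_mkord natr_sum mulr_suml big_mkcond; apply: eq_bigr => u _.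
    rewrite natrM -mulrA -/(mu t u); case: (boolP (bit u X)) => [/IH->|uX].
      by case: bit; rewrite ?mul1r ?mul0r.
    (* Outside [X] the induction hypothesis says nothing, but such states carry no weight. *)
    suff -> : mu t u = 0 by rewrite mulr0 if_same.
    apply: contraNeq uX; rewrite mulf_eq0 negb_or pnatr_eq0 -lt0n => /andP[+ _].
    exact: wX.
  have [] := q01_frac r; set a := `|numq _|%N; set b := `|denq _|%N => -> d0.
  rewrite ler_pdivrMr // mulrAC ler_pdivlMr ?ltr0n // -!natrM ler_nat.
  by rewrite [X in (_ <= X)%N]mulnC.
- have [fX /(_ _ le codeC)[phiC ->]] := fP t tX.
  by rewrite IH.
Qed.
End FromGood.
Lemma provable_decide phi : provable phi -> decide (code phi).
Proof.
move=> pv; apply/ballP => C ltC; apply/ballP => X ltX; apply/implyP => phiC.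
apply/implyP => /ballP good; apply/ballP => s lts; apply/implyP => sX.
have [|mu [f [mu0 mu1 muX fX truth]]] := @good_model (code phi) C X ltC.
  by move=> t /good/implyP.
rewrite -(truth phi phiC (Ordinal lts) sX).
exact: (soundness (X := fun t : 'I__ => bit t X) _ mu0 mu1 muX fX pv).
Qed.

(** * Finite models from the types of worlds *)

Section Completeness.
Variables (R : realType) (c : nat) (phi0 : form P).
Let N := 2 ^ c.+1.

Definition in_theory (v : form P -> bool) x :=
  `[< exists2 psi, code psi = x & bool_eval v psi >].
(** The type of [v] records its truth values on all formulas with code at most [c], a finite set
    closed under subformulas; numbers coding no formula get bit 0. *)
Definition world_type v := bits c.+1 (in_theory v).

Lemma in_theory_code v psi : in_theory v (code psi) = bool_eval v psi.
Proof. by apply/asboolP/idP => [[chi /code_inj ->]|]; last exists psi. Qed.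

Lemma world_type_lt v : world_type v < N.
Proof. exact: bits_lt. Qed.

Lemma bit_world_type v psi : code psi <= c ->
  bit (code psi) (world_type v) = bool_eval v psi.
Proof. by move=> lec; rewrite bit_bits // in_theory_code. Qed.

(** A conjunction of literals over the codes up to [c] defines the type, so that [mu] can measure
    it. *)
Lemma world_type_formula t : t < N ->
  exists A : form P, forall v, bool_eval v A = (world_type v == t).
Proof.
move=> ltt; have lit x : exists A, forall v, bool_eval v A = (in_theory v x == bit x t).
  have [[psi <-]|nocode] := pselect (exists psi : form P, code psi = x).
    exists (if bit (code psi) t then psi else Neg psi) => v.
    by rewrite in_theory_code; case: bit => /=; case: bool_eval.
  (* A type with bit 1 at a number coding no formula is never realised, so a contradiction defines
     it. *)
  exists (if bit x t then Bot phi0 else Neg (Bot phi0)) => v.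
  have -> : in_theory v x = false.
    by apply/asboolPn => -[psi cpsi _]; apply: nocode; exists psi.
  by case: bit => /=; rewrite andbN.
have [A AP] : exists A, forall v,
    bool_eval v A = ball c.+1 (fun x => in_theory v x == bit x t).
  elim: c.+1 => [|n [A AP]]; first by exists (Neg (Bot phi0)) => v /=; rewrite andbN.
  have [A' AP'] := lit n; exists (And A A') => v.
  by rewrite /= AP AP' /ball -addn1 iotaD all_cat /= andbT.
exists A => v; rewrite AP; apply/ballP/eqP => [eqb|<- x lex]; last by rewrite bit_bits.
apply: (@bit_inj c.+1) => //; first exact: world_type_lt.
by move=> x ltx; rewrite bit_bits //; apply/eqP/eqb.
Qed.

(** Finite additivity over the disjoint types in [s], peeled off one at a time by [mu_split]. *)
Lemma mu_types (v : form P -> bool) (chi : nat -> form P) (s : seq nat) (A : form P) :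
  world v -> uniq s ->
  (forall t u, t \in s -> bool_eval u (chi t) = (world_type u == t)) ->
  (forall u, world u -> bool_eval u A -> world_type u \in s) ->
  mu R v A = (\sum_(t <- s) mu R v (And A (chi t)))%R.
Proof.
move=> wv; elim: s A => [|t s IH] A /= us chiP As.
  by rewrite big_nil mu0 // => u wu; apply/negP => /(As u wu).
have /andP[ts {}us] := us.
have chit u : bool_eval u (chi t) = (world_type u == t) by rewrite chiP ?mem_head.
have chis t' u : t' \in s -> bool_eval u (chi t') = (world_type u == t').
  by move=> t's; rewrite chiP // in_cons t's orbT.
rewrite big_cons (mu_split R wv A (chi t)) (IH (And A (Neg (chi t)))) //; last first.
  move=> u wu /= /andP[/(As u wu)]; rewrite chit in_cons => /predU1P[->|//].
  by rewrite eqxx.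
congr (_ + _)%R; apply: eq_big_seq => t' t's; apply: mu_ext => // u wu /=.
rewrite chit chis //; case: (eqVneq (world_type u) t') => [->|_]; last by rewrite !andbF.
by rewrite (_ : t' == t = false) ?andbT //; apply: contraNF ts => /eqP <-.
Qed.

Lemma world_weights (v : form P -> bool) : world v -> exists w,
  let B := (sign_bound N c.+1).+1 in
  [/\ w < B ^ N,
      forall t, t < N -> 0 < dig B w t -> exists2 u, world u & world_type u = t,
      0 < \sum_(0 <= t < N) dig B w t
    & forall (r : q01) psi, code (L r psi) <= c -> v (L r psi) =
        (`|numq (val r)|%N * \sum_(0 <= t < N) dig B w t <=
         `|denq (val r)|%N * \sum_(0 <= t < N) bit (code psi) t * dig B w t)].
Proof.
move=> wv; set B := _.+1.
have /choice[chi chiP] : forall t, exists A : form P, t < N ->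
    forall u, bool_eval u A = (world_type u == t).
  move=> t; case: (ltnP t N) => [/world_type_formula[A AP]|_]; first by exists A.
  by exists phi0.
pose x (t : 'I_N) := mu R v (chi t).
have sumx (A : form P) : mu R v A = (\sum_(t < N) mu R v (And A (chi t)))%R.
  rewrite (@mu_types v chi (iota 0 N) A) ?iota_uniq //.
  - by rewrite -(big_mkord xpredT (fun t => mu R v (And A (chi t)))) /index_iota subn0.
  - by move=> t u; rewrite mem_iota => /chiP.
  - by move=> u _ _; rewrite mem_iota world_type_lt.
have sum1 : (\sum_t x t = 1)%R.
  rewrite -(mu1 R wv (A := Neg (Bot phi0))); last by move=> u _ /=; rewrite andbN.
  by rewrite sumx; apply: eq_bigr => t _; apply: mu_ext => // u _ /=; rewrite andbN.
have sumpsi psi : code psi <= c ->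
    (\sum_(t < N) (bit (code psi) t)%:R * x t = mu R v psi)%R.
  move=> lec; rewrite sumx; apply: eq_bigr => t _.
  have typ u : bool_eval u (chi t) -> bool_eval u psi = bit (code psi) t.
    by rewrite chiP // => /eqP <-; rewrite bit_world_type.
  case: (boolP (bit _ _)) typ => [b|nb] typ.
    rewrite mul1r; apply: mu_ext => // u _ /=.
    by case: (boolP (bool_eval u (chi t))) => [/typ ->|]; rewrite ?andbF.
  rewrite mul0r (mu0 R wv) // => u _ /=; apply/negP => /andP[+ /typ].
  by move=> ->.
(* The real measures [x] of the types become integers [y]. What the weights must satisfy is read off
   from signs of forms: one coordinate for nonnegativity and support, all ones for a positive total,
   [coef] below for the [L]-formulas. *)
have [y [ybound ysign]] := sign_cell x (ltn0Sn c).
have posy (a : 'I_N -> int) : (forall t, (`|a t| <= c.+1)%N) ->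
    (0 < \sum_t (a t)%:~R * x t)%R = (0 < \sum_t a t * y t)%R by exact: ysign.
have single (k : int) t : (`|k| <= 1)%N -> (0 < k%:~R * x t)%R = (0 < k * y t)%R.
  move=> k1; have := posy (fun t' => if t' == t then k else 0%R).
  rewrite (bigD1 t) //= eqxx big1 => [|t' /negPf ->]; last by rewrite mul0r.
  rewrite (bigD1 t) //= eqxx big1 => [|t' /negPf ->]; last by rewrite mul0r.
  by rewrite !addr0; apply => t'; case: ifP => // _; apply: leq_trans k1 _.
have y0 t : (0 <= y t)%R.
  have := single (-1)%R t isT; rewrite mulN1r oppr_gt0 mulN1r oppr_gt0 => e.
  by rewrite leNgt -e -leNgt; apply: mu_ge0.
have yE t : y t = `|y t|%N by rewrite gez0_abs.
pose wt t := if insub t is Some i then `|y i|%N else 0.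
have wtE (t : 'I_N) : wt t = `|y t|%N by rewrite /wt valK.
have wtB t : t < N -> wt t < B.
  move=> ltt; rewrite (wtE (Ordinal ltt)) ltnS.
  exact: leq_trans (ybound _) (sign_bound_recE _ _).
have dE t : t < N -> dig B (digits N B wt) t = wt t by move=> ltt; rewrite dig_digits.
have dS (F : nat -> nat) : \sum_(0 <= t < N) F t * dig B (digits N B wt) t
    = \sum_(t < N) F t * `|y t|%N.
  by rewrite big_mkord; apply: eq_bigr => t _; rewrite dE // wtE.
have dS1 : \sum_(0 <= t < N) dig B (digits N B wt) t = \sum_(t < N) `|y t|%N.
  by rewrite big_mkord; apply: eq_bigr => t _; rewrite dE // wtE.
exists (digits N B wt); split.
- exact: digits_lt.
- move=> t ltt; rewrite dE // (wtE (Ordinal ltt)) => wt0.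
  apply: contrapT => notype; suff : (0 < x (Ordinal ltt))%R.
    rewrite /x (mu0 R wv) ?ltxx // => u wu; rewrite chiP //.
    by apply/eqP => e; apply: notype; exists u.
  have := single 1%R (Ordinal ltt) isT; rewrite !mul1r => ->.
  by rewrite yE ltz_nat.
- rewrite dS1 -ltz_nat; have := posy (fun=> 1%R) (fun=> isT).
  under eq_bigr do rewrite mul1r; rewrite sum1 ltr01 => e.
  rewrite [X in (_ < X)%R](_ : _ = (\sum_t 1 * y t)%R) //.
  by rewrite -natz natr_sum; apply: eq_bigr => t _; rewrite mul1r natz -yE.
move=> r psi lec; rewrite dS dS1.
have [lea leb lex] : [/\ `|numq (val r)| <= c, `|denq (val r)| <= c & code psi <= c].
  have le := leq_trans (cpair_ger 3 _) lec; have le' := leq_trans (cpair_gel _ _) le.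
  by split; [exact: leq_trans (cpair_gel _ _) le'|exact: leq_trans (cpair_ger _ _) le'
    |exact: leq_trans (cpair_ger _ _) le].
rewrite (muP R wv); have [] := q01_frac r.
move: lea leb; set a := `|_|; set b := `|_| => lea leb -> b0.
(* The total being 1, this form takes the value a - b * mu(psi) at [x]; it is positive exactly when
   [L r psi] fails. The code of [L r psi] bounds [a] and [b]. *)
pose coef (t : 'I_N) : int := (a%:Z - (b * bit (code psi) t)%N%:Z)%R.
have coefK t : `|coef t| <= c.+1 by rewrite /coef; case: bit; lia.
have := posy coef coefK.
have -> : (\sum_t (coef t)%:~R * x t = a%:R - b%:R * mu R v psi)%R.
  have -> : (a%:R = \sum_t a%:R * x t)%R by rewrite -mulr_sumr sum1 mulr1.
  rewrite -(sumpsi psi lex) mulr_sumr -sumrB.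
  apply: eq_bigr => t _.
  by rewrite /coef intrB mulrBl -!pmulrn natrM mulrA.
have -> : (\sum_t coef t * y t = (a * \sum_(t < N) `|y t|%N)%N%:Z -
    (b * \sum_(t < N) bit (code psi) t * `|y t|%N)%N%:Z)%R.
  rewrite !PoszM -!natz !natr_sum !mulr_sumr -sumrB; apply: eq_bigr => t _.
  by rewrite /coef mulrBl !natz {1 2}yE PoszM -!mulrA PoszM.
rewrite !subr_gt0 => /(congr1 negb); rewrite -!leNgt lez_nat => <-.
by rewrite rmorphM fmorphV /= !ratr_nat ler_pdivrMr ?ltr0n 1?mulrC // -(ltr0n rat).
Qed.

End Completeness.
(** If [phi] is not provable, some world refutes it. Applied to the set of types realised by worlds,
    the procedure would have to make [phi] true at the type of that world. *)
Lemma decide_provable phi : decide (code phi) -> provable phi.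
Proof.
set c := code phi => dec; apply: contrapT => npv.
have [|v0 wv0 /= v0phi] := @lindenbaum P (Neg phi).
  by move=> pv; apply: npv; apply: pv_weaken pv => v /=; rewrite negbK.
pose N := 2 ^ c.+1.
pose C := bits c.+1 (fun x => `[< exists psi : form P, code psi = x >]).
pose X := bits N (fun t =>
  `[< exists2 v : form P -> bool, world v & world_type c v = t >]).
have bitC x : bit x C -> exists2 psi : form P, code psi = x & x <= c.
  move=> b; have ltx := bit_lt (bits_lt _ _) b.
  by move: b; rewrite bit_bits // => /asboolP[psi]; exists psi.
have codeC psi : code psi <= c -> bit (code psi) C.
  by move=> le; rewrite bit_bits //; apply/asboolP; exists psi.
have typeX v : world v -> bit (world_type c v) X.
  by move=> wv; rewrite bit_bits ?world_type_lt //; apply/asboolP; exists v.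
have bitX t : t < N -> bit t X -> exists2 v, world v & world_type c v = t.
  by move=> ltt; rewrite bit_bits // => /asboolP.
have := elimT (ballP _ _) dec C (bits_lt _ _).
move=> /ballP/(_ X (bits_lt _ _))/implyP/(_ (codeC phi (leqnn _)))/implyP/(_ _)/wrap[].
  apply/ballP => s lts; apply/implyP => /(bitX s lts)[v wv <-] {s lts}.
  apply/good_worldP; split.
  - move=> x lex /bitC[psi /code_Neg[chi _ <-] le].
    have le' := leq_trans (cpair_ger _ _) le.
    by rewrite codeC // (bit_world_type v (psi := Neg chi)) // bit_world_type.
  - move=> x y lex ley /bitC[psi /code_And[chi [chi' [_ <- <-]]] le].
    have le' := leq_trans (cpair_ger _ _) le.
    have le1 := leq_trans (cpair_gel _ _) le'; have le2 := leq_trans (cpair_ger _ _) le'.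
    by rewrite !codeC // (bit_world_type v (psi := And chi chi')) // !bit_world_type.
  - have wn := next_worldP wv.
    exists (world_type c (next_world v)); split; [exact: world_type_lt|exact: typeX|].
    move=> x lex /bitC[psi /code_Next[chi _ <-] le].
    have le' := leq_trans (cpair_ger _ _) le.
    rewrite codeC // (bit_world_type v (psi := Next chi)) // bit_world_type //.
    by rewrite bool_eval_next.
  (* The resulting weights are integers, so any model of the reals serves to obtain them. *)
  have [w [ltw wX w0 wL]] := world_weights Rdefinitions.R c phi wv.
  exists w; split=> // [t ltt /(wX t ltt)[u wu <-]|]; first exact: typeX.
  move=> a b x lea leb lex /bitC[psi /code_L[r [chi [_ <- <- <-]]] le].
  have le' := leq_trans (cpair_ger _ _) (leq_trans (cpair_ger _ _) le).
  by rewrite codeC // (bit_world_type v (psi := L r chi)) // -wL.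
move=> /ballP/(_ _ (world_type_lt _ v0))/implyP/(_ (typeX _ wv0)).
by rewrite bit_world_type // (negPf v0phi).
Qed.

End Decide.

Theorem theorem2p18 (P : countType) : decidable_via (@code P) (@is_theorem P).
Proof.
exists decide; first exact: decide_recursive.
move=> phi; split=> [/decide_provable/provable_theorem //|].
by move=> /theorem_provable/provable_decide.
Qed.
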